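(* Let $M$ be an irreducible weight module over the twisted Heisenberg-Virasoro algebra $\mathcal{L}$. Assume that there exists $\lambda\in\mathbb{C}$ such that $\dim M_\lambda=\infty$. Then $\mathrm{Supp}(M)=\lambda+\mathbb{Z}$, and for every $k\in\mathbb{Z}$ we have $\dim M_{\lambda+k}=\infty$.
   Context: The twisted Heisenberg-Virasoro algebra $\mathcal{L}$ is the complex Lie algebra with $\mathbb{C}$-basis $\{L_m, I_m, C, C_I, C_{LI} \mid m\in\mathbb{Z}\}$ and relations, for all $n,m\in\mathbb{Z}$: $$[L_n,L_m]=(m-n)L_{n+m}+\delta_{n,-m}\tfrac{n^3-n}{12}C,$$ $$[L_n,I_m]=mI_{n+m}+\delta_{n,-m}(n^2+n)C_{LI},$$ $$[I_n,I_m]=n\,\delta_{n,-m}C_I,$$ $$[\mathcal{L},C]=[\mathcal{L},C_{LI}]=[\mathcal{L},C_I]=0.$$ The Cartan subalgebra is $\mathfrak{H}=\mathrm{Span}_{\mathbb{C}}\{L_0,I_0,C,C_{LI},C_I\}$. A weight module over $\mathcal{L}$ is an $\mathfrak{H}$-diagonalizable $\mathcal{L}$-module. For an irreducible weight module $M$, the elements $I_0,C,C_{LI},C_I$ act as scalars and $M=\bigoplus_{\lambda\in\mathbb{C}}M_\lambda$, where $M_\lambda=\{v\in M\mid L_0v=\lambda v\}$ is called the weight space of weight $\lambda$. The support of $M$ is $\mathrm{Supp}(M)=\{\lambda\in\mathbb{C}\mid M_\lambda\neq 0\}$. *)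

(* Defs.v *)
From HB Require Import structures.
From mathcomp Require Import all_boot all_order all_algebra.
From mathcomp Require Import finmap.
From mathcomp.multinomials Require Import monalg.
From mathcomp Require Import ring.
From mathcomp Require Import boolp classical_sets reals.
From mathcomp.real_closed Require Export complex.

Set Implicit Arguments.
Unset Strict Implicit.
Unset Printing Implicit Defensive.

Import Order.TTheory GRing.Theory Num.Theory.
Local Open Scope classical_set_scope.
Local Open Scope ring_scope.

HB.mixin Record Lmodule_isLieAlgebra (F : fieldType) L of GRing.Lmodule F L := {
  lieb : L -> L -> L;
  lieb_linearl : forall y : L, linear (lieb^~ y);
  lieb_linearr : forall x : L, linear (lieb x);
  liebxx : forall x : L, lieb x x = 0;
  lieb_jacobi : forall x y z : L,
    lieb x (lieb y z) + lieb y (lieb z x) + lieb z (lieb x y) = 0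
}.

#[short(type="lieAlgType")]
HB.structure Definition LieAlgebra (F : fieldType) :=
  {L of GRing.Lmodule F L & Lmodule_isLieAlgebra F L}.

HB.mixin Record Lmodule_isLieModule (F : fieldType) (L : lieAlgType F) V
    of GRing.Lmodule F V := {
  lact : L -> V -> V;
  lact_linearl : forall v : V, linear (lact^~ v);
  lact_linearr : forall x : L, linear (lact x);
  lact_lieb : forall (x y : L) (v : V),
    lact (lieb x y) v = lact x (lact y v) - lact y (lact x v)
}.

#[short(type="lieModType")]
HB.structure Definition LieModule (F : fieldType) (L : lieAlgType F) :=
  {V of GRing.Lmodule F V & Lmodule_isLieModule F L V}.

Section LieModuleTheory.
Variables (F : fieldType) (L : lieAlgType F) (V : lieModType L).

Definition is_submodule (W : set V) : Prop :=
  [/\ W 0,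
      forall u v, W u -> W v -> W (u + v),
      forall (a : F) v, W v -> W (a *: v) &
      forall (x : L) v, W v -> W (lact x v)].

Definition irreducible_module : Prop :=
  (exists v : V, v != 0) /\
  forall W : set V, is_submodule W -> W = [set 0] \/ W = [set: V].

Definition weight_vector (H : set L) (v : V) : Prop :=
  exists mu : L -> F, forall h, H h -> lact h v = mu h *: v.

(* V is the sum of its simultaneous H-eigenspaces; eigenspaces attached to
   distinct weights being independent, the sum is automatically direct. *)
Definition diagonalizable_module (H : set L) : Prop :=
  forall v : V, exists s : seq V,
    (forall w, w \in s -> weight_vector H w) /\ v = \sum_(w <- s) w.

End LieModuleTheory.

Definition fin_dim (F : fieldType) (V : lmodType F) (W : set V) : Prop :=
  exists (n : nat) (b : 'I_n -> V),
    (forall i, W (b i)) /\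
    forall v, W v -> exists c : 'I_n -> F, v = \sum_(i < n) c i *: b i.

Definition infinite_dim (F : fieldType) (V : lmodType F) (W : set V) : Prop :=
  ~ fin_dim W.

Inductive HVgen := genL of int | genI of int | genC | genCI | genCLI.

Definition HVgen_encode (g : HVgen) : int + int + 'I_3 :=
  match g with
  | genL n => inl (inl n)
  | genI n => inl (inr n)
  | genC => inr 0
  | genCI => inr 1
  | genCLI => inr 2
  end.

Definition HVgen_decode (c : int + int + 'I_3) : HVgen :=
  match c with
  | inl (inl n) => genL n
  | inl (inr n) => genI n
  | inr i => if i == 0 then genC else if i == 1 then genCI else genCLI
  end.

Lemma HVgen_encodeK : cancel HVgen_encode HVgen_decode.
Proof. by case. Qed.

HB.instance Definition _ := Choice.copy HVgen (can_type HVgen_encodeK).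

Section FreeModule.
Variables (F : fieldType) (K : choiceType) (V : lmodType F).
Implicit Types (f g : K -> V) (x y : {malg F[K]}).

Definition lin_ext f x : V := \sum_(k <- msupp x) x@_k *: f k.

Lemma lin_extEw f x (d : {fset K}) :
  (msupp x `<=` d)%fset -> lin_ext f x = \sum_(k <- d) x@_k *: f k.
Proof.
move=> le_d; rewrite /lin_ext (big_fset_incl _ le_d) // => k _ /mcoeff_outdom ->.
by rewrite scale0r.
Qed.

Lemma lin_ext_linear f : linear (lin_ext f).
Proof.
move=> a x y; pose d := (msupp x `|` msupp y `|` msupp (a *: x + y))%fset.
have lex : (msupp x `<=` d)%fset by apply/fsubsetP => k; rewrite !inE => ->.
have ley : (msupp y `<=` d)%fset.
  by apply/fsubsetP => k; rewrite !inE => ->; rewrite orbT.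
have lexy : (msupp (a *: x + y) `<=` d)%fset.
  by apply/fsubsetP => k; rewrite !inE => ->; rewrite orbT.
rewrite (lin_extEw f lex) (lin_extEw f ley) (lin_extEw f lexy).
rewrite scaler_sumr -big_split /=; apply: eq_bigr => k _.
by rewrite mcoeffD mcoeffZ scalerDl scalerA.
Qed.

Lemma lin_extU f k : lin_ext f << k >> = f k.
Proof.
by rewrite /lin_ext msuppU oner_eq0 big_seq_fset1 mcoeffUU scale1r.
Qed.

Lemma malg_lin_ind (P : {malg F[K]} -> Prop) :
  P 0 -> (forall a k x, P x -> P (a *: << k >> + x)) -> forall x, P x.
Proof.
move=> P0 PD x; rewrite [x]monalgE.
elim: (enum_fset _) => [|k s IH]; first by rewrite big_nil.
rewrite big_cons; have -> : << x@_k *g k >> = x@_k *: << k >> :> {malg F[K]}.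
  by apply/malgP => k'; rewrite mcoeffZ !mcoeffU mulrnAr mulr1.
exact: PD.
Qed.

End FreeModule.

(* The twisted Heisenberg-Virasoro algebra: finitely supported F-combinations
   of the generators, with the bracket extended bilinearly. *)
Definition HV (F : fieldType) : Type := {malg F[HVgen]}.

HB.instance Definition _ (F : fieldType) :=
  GRing.Lmodule.copy (HV F) {malg F[HVgen]}.

HB.lock Definition HV_gen (F : fieldType) (g : HVgen) : HV F := << g >>.

Section HV.
Variable F : fieldType.

Definition HV_L (n : int) : HV F := HV_gen F (genL n).
Definition HV_I (n : int) : HV F := HV_gen F (genI n).
Definition HV_C : HV F := HV_gen F genC.
Definition HV_CI : HV F := HV_gen F genCI.
Definition HV_CLI : HV F := HV_gen F genCLI.

Definition HV_gen_LL (n m : int) : HV F :=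
  (m - n)%:~R *: HV_L (n + m)
  + ((n == - m)%:R * ((n ^+ 3 - n)%:~R / 12)) *: HV_C.

Definition HV_gen_LI (n m : int) : HV F :=
  m%:~R *: HV_I (n + m) + ((n == - m)%:R * (n ^+ 2 + n)%:~R) *: HV_CLI.

Definition HV_gen_II (n m : int) : HV F := (n%:~R * (n == - m)%:R) *: HV_CI.

Definition HV_gen_lieb (g h : HVgen) : HV F :=
  match g, h with
  | genL n, genL m => HV_gen_LL n m
  | genL n, genI m => HV_gen_LI n m
  | genI n, genL m => - HV_gen_LI m n
  | genI n, genI m => HV_gen_II n m
  | _, _ => 0
  end.

End HV.

HB.lock Definition HV_lieb (F : fieldType) (x y : HV F) : HV F :=
  lin_ext (fun g => lin_ext (HV_gen_lieb F g) y) x.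

Arguments HV_lieb {F} x y.

Section HVTheory.
Variable F : fieldType.
Implicit Types x y z : HV F.

Lemma HV_lieb_linearl y : linear (HV_lieb^~ y).
Proof. by move=> a x1 x2; rewrite HV_lieb.unlock lin_ext_linear. Qed.

Lemma HV_lieb_linearr x : linear (HV_lieb x).
Proof.
move=> a y1 y2; rewrite HV_lieb.unlock /lin_ext scaler_sumr -big_split /=.
apply: eq_bigr => k _; rewrite -/(lin_ext (HV_gen_lieb F k) _).
by rewrite lin_ext_linear scalerDr !scalerA mulrC.
Qed.

Lemma HV_liebDl x1 x2 y : HV_lieb (x1 + x2) y = HV_lieb x1 y + HV_lieb x2 y.
Proof. by have := HV_lieb_linearl y 1 x1 x2; rewrite !scale1r. Qed.

Lemma HV_liebDr x y1 y2 : HV_lieb x (y1 + y2) = HV_lieb x y1 + HV_lieb x y2.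
Proof. by have := HV_lieb_linearr x 1 y1 y2; rewrite !scale1r. Qed.

Lemma HV_lieb0l y : HV_lieb 0 y = 0.
Proof. by rewrite HV_lieb.unlock /lin_ext msupp0 big_seq_fset0. Qed.

Lemma HV_lieb0r x : HV_lieb x 0 = 0.
Proof.
by have := HV_lieb_linearr x (-1) 0 0; rewrite scaler0 addr0 scaleN1r addNr.
Qed.

Lemma HV_liebZl a x y : HV_lieb (a *: x) y = a *: HV_lieb x y.
Proof. by have := HV_lieb_linearl y a x 0; rewrite !addr0 HV_lieb0l addr0. Qed.

Lemma HV_liebZr a x y : HV_lieb x (a *: y) = a *: HV_lieb x y.
Proof. by have := HV_lieb_linearr x a y 0; rewrite !addr0 HV_lieb0r addr0. Qed.

Lemma HV_liebNr x y : HV_lieb x (- y) = - HV_lieb x y.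
Proof. by rewrite -scaleN1r HV_liebZr scaleN1r. Qed.

Lemma HV_liebU g h : HV_lieb (HV_gen F g) (HV_gen F h) = HV_gen_lieb F g h.
Proof. by rewrite HV_lieb.unlock HV_gen.unlock !lin_extU. Qed.

Lemma HV_lin_ind (P : HV F -> Prop) :
  P 0 -> (forall a g x, P x -> P (a *: HV_gen F g + x)) -> forall x, P x.
Proof. by rewrite HV_gen.unlock; exact: malg_lin_ind. Qed.

Lemma HV_gen_liebxx g : HV_gen_lieb F g g = 0.
Proof.
case: g => //= n; rewrite /HV_gen_LL /HV_gen_II.
- rewrite subrr scale0r add0r; case: eqP => [/eqP|_]; last by rewrite mul0r scale0r.
  rewrite -addr_eq0 -mulr2n mulrn_eq0 /= => /eqP ->.
  by rewrite expr0n /= subr0 mul0r mulr0 scale0r.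
- case: eqP => [/eqP|_]; last by rewrite mulr0 scale0r.
  by rewrite -addr_eq0 -mulr2n mulrn_eq0 /= => /eqP ->; rewrite mul0r scale0r.
Qed.

Lemma scale_opp2 (V : lmodType F) (a b a' b' : F) (u v : V) :
  a = - a' -> b = - b' -> a *: u + b *: v = - (a' *: u + b' *: v).
Proof. by move=> -> ->; rewrite opprD !scaleNr. Qed.

Lemma HV_gen_liebC g h : HV_gen_lieb F g h = - HV_gen_lieb F h g.
Proof.
have eqN (n m : int) : (n == - m) = (m == - n) by rewrite -!addr_eq0 addrC.
case: g h => [n|n|||] [m|m|||] //=; rewrite ?opprK ?oppr0 //.
- rewrite /HV_gen_LL [in LHS](addrC n m); apply: scale_opp2.
    by rewrite -rmorphN opprB.
  by rewrite eqN; case: eqP => [->|_]; rewrite ?mul0r ?oppr0 // !mul1r; ring.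
- rewrite /HV_gen_II -scaleNr; congr (_ *: _); rewrite eqN.
  by case: eqP => [->|_]; rewrite ?mulr0 ?oppr0 // !mulr1 -rmorphN opprK.
Qed.

Lemma HV_liebC x y : HV_lieb x y = - HV_lieb y x.
Proof.
elim/HV_lin_ind: x => [|a g x IHx]; first by rewrite HV_lieb0l HV_lieb0r oppr0.
rewrite HV_liebDl HV_liebDr HV_liebZl HV_liebZr IHx opprD; congr (_ + _).
rewrite -scalerN; congr (_ *: _).
elim/HV_lin_ind: y {IHx} => [|b h y IHy].
  by rewrite HV_lieb0l HV_lieb0r oppr0.
rewrite HV_liebDl HV_liebDr HV_liebZl HV_liebZr IHy opprD; congr (_ + _).
by rewrite -scalerN !HV_liebU HV_gen_liebC.
Qed.

Lemma HV_liebxx x : HV_lieb x x = 0.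
Proof.
elim/HV_lin_ind: x => [|a g x IHx]; first by rewrite HV_lieb0l.
rewrite HV_liebDl !HV_liebDr IHx addr0 [HV_lieb x _]HV_liebC addrK.
by rewrite HV_liebZl HV_liebZr HV_liebU HV_gen_liebxx !scaler0.
Qed.

Definition HV_jac (x y z : HV F) : HV F :=
  HV_lieb x (HV_lieb y z) + HV_lieb y (HV_lieb z x) + HV_lieb z (HV_lieb x y).

Lemma HV_jacC x y z : HV_jac x y z = HV_jac y z x.
Proof.
by rewrite /HV_jac -addrA [RHS]addrC.
Qed.

Lemma HV_jacN x y z : HV_jac x z y = - HV_jac x y z.
Proof.
rewrite /HV_jac (HV_liebC z y) (HV_liebC y x) (HV_liebC x z) !HV_liebNr.
by rewrite !opprD addrAC.
Qed.

Lemma HV_jac_linear y z : linear (fun x => HV_jac x y z).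
Proof.
move=> a x1 x2; rewrite /HV_jac !(HV_liebDl, HV_liebDr, HV_liebZl, HV_liebZr).
by rewrite !scalerDr [X in X + _ = _]addrACA [LHS]addrACA.
Qed.

Lemma HV_jac_ind x y z :
  (forall g, HV_jac (HV_gen F g) y z = 0) -> HV_jac x y z = 0.
Proof.
move=> Jg; elim/HV_lin_ind: x => [|a g x IHx].
  have := HV_jac_linear y z (-1) 0 0.
  by rewrite /= scaler0 addr0 scaleN1r addNr.
by rewrite (HV_jac_linear y z) IHx Jg scaler0 addr0.
Qed.

Lemma HV_lieb_genC g : HV_lieb (HV_gen F g) (HV_C F) = 0.
Proof. by rewrite HV_liebU; case: g. Qed.

Lemma HV_lieb_genCI g : HV_lieb (HV_gen F g) (HV_CI F) = 0.
Proof. by rewrite HV_liebU; case: g. Qed.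

Lemma HV_lieb_genCLI g : HV_lieb (HV_gen F g) (HV_CLI F) = 0.
Proof. by rewrite HV_liebU; case: g. Qed.

Lemma HV_lieb_lin1 x a y c : HV_lieb x c = 0 -> forall b,
  HV_lieb x (a *: y + b *: c) = a *: HV_lieb x y.
Proof. by move=> xc0 b; rewrite HV_lieb_linearr HV_liebZr xc0 scaler0 addr0. Qed.

Lemma scale_collect (V : lmodType F) (c1 c2 c3 a1 a2 a3 b1 b2 b3 : F) (u v : V) :
  c1 * a1 + c2 * a2 + c3 * a3 = 0 -> c1 * b1 + c2 * b2 + c3 * b3 = 0 ->
  c1 *: (a1 *: u + b1 *: v) + c2 *: (a2 *: u + b2 *: v)
  + c3 *: (a3 *: u + b3 *: v) = 0.
Proof.
move=> a0 b0; rewrite !scalerDr !scalerA [X in X + _ = _]addrACA [LHS]addrACA.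
by rewrite -!scalerDl a0 b0 !scale0r addr0.
Qed.

Lemma scale_collectN (V : lmodType F) (c1 c2 c3 a1 a2 a3 b1 b2 b3 : F)
    (u v : V) :
  c1 * a1 - c2 * a2 - c3 * a3 = 0 -> c1 * b1 - c2 * b2 - c3 * b3 = 0 ->
  c1 *: (a1 *: u + b1 *: v) - c2 *: (a2 *: u + b2 *: v)
  + c3 *: - (a3 *: u + b3 *: v) = 0.
Proof.
move=> a0 b0; rewrite scalerN -!scaleNr.
by apply: scale_collect; rewrite !mulNr.
Qed.

Lemma HV_jacLLL n m k : HV_jac (HV_L F n) (HV_L F m) (HV_L F k) = 0.
Proof.
rewrite /HV_jac !HV_liebU /HV_gen_lieb /HV_gen_LL.
rewrite !(HV_lieb_lin1 _ _ (HV_lieb_genC _)) !HV_liebU /HV_gen_lieb /HV_gen_LL.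
have -> : m + (k + n) = n + (m + k) by ring.
have -> : k + (n + m) = n + (m + k) by ring.
apply: scale_collect; first by ring.
rewrite -!addr_eq0.
have -> : m + (k + n) = n + (m + k) by ring.
have -> : k + (n + m) = n + (m + k) by ring.
case: eqP => [|_]; last by rewrite !mul0r !mulr0 !addr0.
by move/eqP; rewrite addr_eq0 => /eqP ->; ring.
Qed.

Lemma HV_jacLLI n m k : HV_jac (HV_L F n) (HV_L F m) (HV_I F k) = 0.
Proof.
rewrite /HV_jac !HV_liebU /HV_gen_lieb /HV_gen_LL /HV_gen_LI HV_liebNr.
rewrite !(HV_lieb_lin1 _ _ (HV_lieb_genC _)).
rewrite !(HV_lieb_lin1 _ _ (HV_lieb_genCLI _)) !HV_liebU /HV_gen_lieb /HV_gen_LI.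
have -> : m + (n + k) = n + (m + k) by ring.
have -> : n + m + k = n + (m + k) by ring.
apply: scale_collectN; first by ring.
rewrite -!addr_eq0.
have -> : m + (n + k) = n + (m + k) by ring.
have -> : n + m + k = n + (m + k) by ring.
case: eqP => [|_]; last by rewrite !mul0r !mulr0 !subr0.
by move/eqP; rewrite addrA addrC addr_eq0 => /eqP ->; ring.
Qed.

Lemma HV_jacLII n m k : HV_jac (HV_L F n) (HV_I F m) (HV_I F k) = 0.
Proof.
rewrite /HV_jac !HV_liebU /HV_gen_lieb /HV_gen_II /HV_gen_LI HV_liebNr.
rewrite HV_liebZr HV_lieb_genCI scaler0 add0r.
rewrite !(HV_lieb_lin1 _ _ (HV_lieb_genCLI _)) !HV_liebU /HV_gen_lieb /HV_gen_II.
rewrite !scalerA -scaleNr -scalerDl; apply/eqP; rewrite scaler_eq0; apply/orP.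
left; apply/eqP; rewrite -!addr_eq0.
have -> : m + (n + k) = n + (m + k) by ring.
have -> : k + (n + m) = n + (m + k) by ring.
by ring.
Qed.

Lemma HV_jacIII n m k : HV_jac (HV_I F n) (HV_I F m) (HV_I F k) = 0.
Proof.
rewrite /HV_jac !HV_liebU /HV_gen_lieb /HV_gen_II !HV_liebZr !HV_lieb_genCI.
by rewrite !scaler0 !addr0.
Qed.

Definition HV_noncentral g := match g with genL _ | genI _ => true | _ => false end.

Lemma HV_jac_gen_central g y z : ~~ HV_noncentral g -> HV_jac (HV_gen F g) y z = 0.
Proof.
move=> cg; have liebg0 t : HV_lieb (HV_gen F g) t = 0.
  elim/HV_lin_ind: t => [|a h t IHt]; first exact: HV_lieb0r.
  rewrite HV_lieb_linearr IHt addr0 HV_liebU.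
  by case: g cg {IHt} => //= *; rewrite scaler0.
rewrite /HV_jac [HV_lieb z (HV_gen F g)]HV_liebC !liebg0 oppr0.
by rewrite !HV_lieb0r !addr0.
Qed.

Lemma HV_lieb_jacobi x y z : HV_jac x y z = 0.
Proof.
apply: HV_jac_ind => g; rewrite HV_jacC; apply: HV_jac_ind => h.
rewrite HV_jacC; apply: HV_jac_ind => k; rewrite HV_jacC.
have [|cg] := boolP (HV_noncentral g); last exact: HV_jac_gen_central.
have [|ch] := boolP (HV_noncentral h); last first.
  by rewrite HV_jacC HV_jac_gen_central.
have [|ck] := boolP (HV_noncentral k); last first.
  by rewrite -HV_jacC HV_jac_gen_central.
case: k => // k _; case: h => // m _; case: g => // n _.
- exact: HV_jacLLL.
- by rewrite HV_jacC; exact: HV_jacLLI.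
- by rewrite -HV_jacC; exact: HV_jacLLI.
- by rewrite -HV_jacC; exact: HV_jacLII.
- exact: HV_jacLLI.
- by rewrite HV_jacC; exact: HV_jacLII.
- exact: HV_jacLII.
- exact: HV_jacIII.
Qed.

HB.instance Definition _ := Lmodule_isLieAlgebra.Build F (HV F)
  HV_lieb_linearl HV_lieb_linearr HV_liebxx HV_lieb_jacobi.

Lemma HV_lieb_LL n m :
  lieb (HV_L F n) (HV_L F m) = (m - n)%:~R *: HV_L F (n + m)
    + ((n == - m)%:R * ((n ^+ 3 - n)%:~R / 12)) *: HV_C F.
Proof. exact: HV_liebU. Qed.

Lemma HV_lieb_LI n m :
  lieb (HV_L F n) (HV_I F m) = m%:~R *: HV_I F (n + m)
    + ((n == - m)%:R * (n ^+ 2 + n)%:~R) *: HV_CLI F.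
Proof. exact: HV_liebU. Qed.

Lemma HV_lieb_II n m :
  lieb (HV_I F n) (HV_I F m) = (n%:~R * (n == - m)%:R) *: HV_CI F.
Proof. exact: HV_liebU. Qed.

Lemma HV_lieb_central x :
  [/\ lieb x (HV_C F) = 0, lieb x (HV_CLI F) = 0 & lieb x (HV_CI F) = 0].
Proof.
by elim/HV_lin_ind: x => [|a g x [IH1 IH2 IH3]]; split;
  rewrite /lieb /= ?HV_lieb0l // HV_lieb_linearl (HV_lieb_genC, HV_lieb_genCLI,
  HV_lieb_genCI) scaler0 add0r.
Qed.

Definition HV_cartan : set (HV F) :=
  [set h | exists a b c d e : F,
    h = a *: HV_L F 0 + b *: HV_I F 0 + c *: HV_C F + d *: HV_CLI F
        + e *: HV_CI F].

Variable M : lieModType (HV F).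

Definition weight_module : Prop := diagonalizable_module M HV_cartan.

Definition weight_space (lambda : F) : set M :=
  [set v | lact (HV_L F 0) v = lambda *: v].

Definition Supp : set F := [set lambda | exists2 v, weight_space lambda v & v != 0].

End HVTheory.

Arguments weight_module {F} M.
Arguments weight_space {F} M lambda.
Arguments Supp {F} M.

(* Main.v *)
Require Import Defs.
From HB Require Import structures.
From mathcomp Require Import all_boot all_order all_algebra.
From mathcomp Require Import boolp classical_sets reals.
From mathcomp.real_closed Require Import complex.
From mathcomp Require Import ring zify.

(** Write M_k for the weight space of weight lambda + k.  The theorem follows by
    induction on k, in both directions, from one step: if M_(-1) is
    infinite-dimensional, then so is M_0 (lemma [infinite_weight_succ]).  The
    downward step is the upward one for the mirrored action, in which L_n
    becomes - L_(-n) and I_n becomes I_(-n); this is why almost everything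
    is stated for an abstract family of operators ([virOp], [hvOp])
    that satisfies the commutation relations and on which the mirror acts.  That
    no weight lies outside lambda + Z is a matter of eigenvalues: the vectors
    killed by some product of factors L_0 - (lambda + k) form a submodule.

    For the step, suppose M_0 is finite-dimensional and M_(-1) is not.  Finitely
    many operators of degree 1 map M_(-1) to M_0, hence have a common kernel
    vector v <> 0 in M_(-1).  The point is that ten such operators suffice to
    reach a contradiction ([degree1_conditions]).

    First, a highest weight vector would generate M and make all weight spaces
    finite-dimensional ([hw_fin_dim]), so there is none, and by mirroring there
    is no lowest weight vector either.  In particular w = L_2 v is nonzero, as
    L_1 v = I_1 v = 0.  Comparing brackets on w, which is killed by all I_n with
    n <> 0, shows that the central charges of the Heisenberg part vanish as far
    as needed for the common kernel of the I_n, n <> 0, to be a submodule; thus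
    these I_n act by zero ([hvI_vanish]) and only the Virasoro operators remain.

    Let a be the weight of M_0.  The vector
    r = (4a - 6) L_(-2) v - 3 L_(-1)^2 v is killed by L_1 and L_3; the
    conditions on v force L_2 r, and then r, to be a highest weight vector or
    zero, provided a <> -1.  The case a = -1 is the mirror image of a = 1, which
    is excluded directly.  So r = 0 and L_(-2) L_2 v = tau v for an explicit
    scalar tau ([half_relations]).  The analogous vector one degree lower gives a second
    equation between a and tau ([second_relation]).  Together with the mirrored
    equations, where a becomes - a and the central charge changes sign, they
    leave only a = 0, central charge 0 and tau = -1 ([constants]).  These are the
    values of the module of Laurent polynomials modulo constants, on which
    L_n = t^(n+1) d/dt, with v = 1/t.  And indeed the lines spanned by
    L_1^k w and L_(-1)^k v turn out to be stable under all L_n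
    ([function_module]), by an induction that uses the absence of lowest weight
    vectors at each step.  They span a submodule with one-dimensional weight
    spaces, which is all of M: a contradiction. *)

Set Implicit Arguments.
Unset Strict Implicit.
Unset Printing Implicit Defensive.

Import Order.TTheory GRing.Theory Num.Theory.
Local Open Scope classical_set_scope.
Local Open Scope ring_scope.

(** * Deciding identities between vectors *)

(** The square-zero extension of F by M, a commutative ring in which M is an
    ideal of square zero.  Embedding M into it turns an identity between linear
    combinations of vectors into one that [ring] decides. *)
Definition sqz (F : fieldType) (M : lmodType F) : Type := (F * M)%type.

HB.instance Definition _ (F : fieldType) (M : lmodType F) :=
  GRing.Zmodule.copy (sqz M) (F * M)%type.

Section SquareZero.
Variables (F : fieldType) (M : lmodType F).
Local Notation S := (sqz M).

Definition sqz_one : S := (1, 0).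
Definition sqz_mul (s t : S) : S := (s.1 * t.1, s.1 *: t.2 + t.1 *: s.2).

Lemma sqz_mulA : associative sqz_mul.
Proof.
move=> [a u] [b v] [d w]; rewrite /sqz_mul /= mulrA; congr (_, _).
by rewrite !scalerDr !scalerA addrA (mulrC d a) (mulrC d b).
Qed.

Lemma sqz_mulC : commutative sqz_mul.
Proof. by move=> [a u] [b v]; rewrite /sqz_mul /= mulrC addrC. Qed.

Lemma sqz_mul1 : left_id sqz_one sqz_mul.
Proof. by move=> [a u]; rewrite /sqz_mul /= mul1r scale1r scaler0 addr0. Qed.

Lemma sqz_mulDl : left_distributive sqz_mul +%R.
Proof.
move=> [a u] [b v] [d w]; rewrite /sqz_mul /=.
by rewrite mulrDl scalerDl scalerDr addrACA.
Qed.

Lemma sqz_one_neq0 : sqz_one != 0.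
Proof. by apply/eqP => -[/eqP]; rewrite oner_eq0. Qed.

HB.instance Definition _ := GRing.Zmodule_isComNzRing.Build S
  sqz_mulA sqz_mulC sqz_mul1 sqz_mulDl sqz_one_neq0.

Definition sqz_scalar (a : F) : S := (a, 0).
Definition sqz_vector (u : M) : S := (0, u).

Lemma sqz_scalar_zmod : zmod_morphism sqz_scalar.
Proof. by move=> a b; congr (_, _); rewrite /= subrr. Qed.

Lemma sqz_scalar_monoid : monoid_morphism sqz_scalar.
Proof. by split=> // a b; congr (_, _); rewrite /= !scaler0 addr0. Qed.

HB.instance Definition _ :=
  GRing.isZmodMorphism.Build F S sqz_scalar sqz_scalar_zmod.
HB.instance Definition _ :=
  GRing.isMonoidMorphism.Build F S sqz_scalar sqz_scalar_monoid.

Lemma sqz_vector_zmod : zmod_morphism sqz_vector.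
Proof. by move=> u v; congr (_, _); rewrite /= subrr. Qed.

HB.instance Definition _ :=
  GRing.isZmodMorphism.Build M S sqz_vector sqz_vector_zmod.

Lemma sqz_vectorD u v : sqz_vector (u + v) = sqz_vector u + sqz_vector v.
Proof. exact: raddfD. Qed.

Lemma sqz_vectorN u : sqz_vector (- u) = - sqz_vector u.
Proof. exact: raddfN. Qed.

Lemma sqz_vectorZ a u : sqz_vector (a *: u) = sqz_scalar a * sqz_vector u.
Proof. by congr (_, _); rewrite /= ?mulr0 // scale0r addr0. Qed.

Lemma sqz_vector_inj : injective sqz_vector.
Proof. by move=> u v []. Qed.

End SquareZero.

(** Once the embedding is pushed inside, only scalars and vectors that are not
    linear combinations are left as atoms for [ring]. *)
Ltac vring :=
  apply: sqz_vector_inj;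
  rewrite ?(sqz_vectorD, sqz_vectorN, sqz_vectorZ, raddf0 (@sqz_vector _ _));
  ring.

(** * Finite and infinite dimension *)

Section LinearAlgebra.
Variables (F : fieldType) (M : lmodType F).
Implicit Types (W : set M) (s t : seq M) (u v : M).

Definition subspace W : Prop :=
  [/\ W 0, forall u v, W u -> W v -> W (u + v) &
      forall (a : F) u, W u -> W (a *: u)].

Lemma subspace_sum W (I : Type) (r : seq I) (P : pred I) (f : I -> M) :
  subspace W -> (forall i, P i -> W (f i)) -> W (\sum_(i <- r | P i) f i).
Proof. by case=> W0 WD _ Wf; elim/big_ind: _. Qed.

Lemma subspaceB W u v : subspace W -> W u -> W v -> W (u - v).
Proof. by case=> _ WD WZ Wu Wv; rewrite -scaleN1r; apply/WD/WZ. Qed.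

Definition span s : set M :=
  [set u | exists c : nat -> F, u = \sum_(i < size s) c i *: s`_i].

Lemma span_subspace s : subspace (span s).
Proof.
split=> [|u v [c ->] [d ->]|a u [c ->]].
- by exists (fun=> 0); rewrite big1 // => i _; rewrite scale0r.
- exists (fun i => c i + d i); rewrite -big_split /=.
  by apply: eq_bigr => i _; rewrite scalerDl.
- exists (fun i => a * c i); rewrite scaler_sumr.
  by apply: eq_bigr => i _; rewrite scalerA.
Qed.

Lemma span0 s : span s 0.
Proof. by case: (span_subspace s). Qed.

Lemma spanD s u v : span s u -> span s v -> span s (u + v).
Proof. by case: (span_subspace s) => _ + _; apply. Qed.

Lemma spanZ s a u : span s u -> span s (a *: u).
Proof. by case: (span_subspace s) => _ _; apply. Qed.

Lemma spanB s u w : span s u -> span s w -> span s (u - w).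
Proof. by move=> su sw; apply: subspaceB => //; exact: span_subspace. Qed.

Lemma mem_span s u : u \in s -> span s u.
Proof.
move=> us; exists (fun i => (i == index u s)%:R).
rewrite (bigD1 (Ordinal (etrans (index_mem u s) us))) //=.
rewrite eqxx scale1r nth_index // big1 ?addr0 // => i.
by rewrite -val_eqE /= => /negPf ->; rewrite scale0r.
Qed.

Lemma span_sub W s u :
  subspace W -> (forall b, b \in s -> W b) -> span s u -> W u.
Proof.
move=> subW Ws [c ->]; apply: subspace_sum => // i _.
by case: (subW) => _ _ WZ; apply/WZ/Ws/mem_nth.
Qed.

Lemma span_img s t (phi : {linear M -> M}) :
  (forall b, b \in s -> span t (phi b)) -> forall u, span s u -> span t (phi u).
Proof.
move=> st u; apply: (@span_sub [set u | span t (phi u)]) => //.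
split=> [|x y|a x] /=; rewrite ?linear0 ?linearD ?linearZ /=.
- exact: span0.
- exact: spanD.
- exact: spanZ.
Qed.

Lemma span_nil u : span [::] u -> u = 0.
Proof. by case=> c ->; rewrite big_ord0. Qed.

Lemma fin_dim_span W s :
  (forall b, b \in s -> W b) -> (forall u, W u -> span s u) -> fin_dim W.
Proof.
move=> sW Ws; exists (size s), (fun i => s`_i).
split=> [i|u /Ws [c ->]]; first exact/sW/mem_nth.
by exists (fun i => c i).
Qed.

Lemma fin_dimP W : fin_dim W ->
  exists2 s, forall b, b \in s -> W b & forall u, W u -> span s u.
Proof.
case=> n [b [Wb Wspan]]; exists (codom b) => [_ /codomP[i ->] //|u /Wspan [c ->]].
apply: subspace_sum => [|i _]; first exact: span_subspace.
exact/spanZ/mem_span/codom_f.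
Qed.

Lemma infinite_dim_neq0 W : infinite_dim W -> exists2 u, W u & u != 0.
Proof.
move=> infW; apply: contrapT => W0; apply: infW.
apply: (@fin_dim_span _ [::]) => // u Wu.
suff -> : u = 0 by exact: span0.
by apply: contrapT => /eqP u0; apply: W0; exists u.
Qed.

(** Induction on the spanning sequence of the target: either the vectors whose
    image lies in the span of the remaining generators are everything, or they
    have codimension one, a complement being spanned by any other vector. *)
Lemma fin_dim_kernel (phi : {linear M -> M}) s W :
  subspace W -> (forall u, W u -> span s (phi u)) ->
  fin_dim [set u | W u /\ phi u = 0] -> fin_dim W.
Proof.
elim: s W => [|b s IH] W subW phiW finK.
  suff <- : [set u | W u /\ phi u = 0] = W by [].
  by apply/seteqP; split=> [u []|u Wu] //; split=> //; apply/span_nil/phiW.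
have [W0 WD WZ] := subW.
have consP u : span (b :: s) u -> exists a y, span s y /\ u = a *: b + y.
  case=> c ->; rewrite big_ord_recl; exists (c 0%N), (\sum_(i < size s) c i.+1 *: s`_i).
  by split=> //; exists (fun i => c i.+1).
pose W' := [set u | W u /\ span s (phi u)].
have subW' : subspace W'.
  split=> [|u v [Wu su] [Wv sv]|a u [Wu su]].
  - by split=> //; rewrite linear0; exact: span0.
  - by split; [exact: WD | rewrite linearD; exact: spanD].
  - by split; [exact: WZ | rewrite linearZ; exact: spanZ].
have : fin_dim W'.
  apply: IH => // [u []|] //.
  suff -> : [set u | W' u /\ phi u = 0] = [set u | W u /\ phi u = 0] by [].
  apply/seteqP; split=> [u [[]]|u [Wu u0]] //; split=> //; split=> //.
  by rewrite u0; exact: span0.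
case/fin_dimP=> t tW' W't.
have [[w Ww Nw]|noW] := pselect (exists2 w, W w & ~ W' w); last first.
  apply: (@fin_dim_span _ t) => [x /tW' []|u Wu] //; apply/W't.
  by apply: contrapT => NW'u; apply: noW; exists u.
apply: (@fin_dim_span _ (w :: t)) => [x|u Wu].
  by rewrite inE => /predU1P[->|/tW' []].
have [a [y [sy wE]]] := consP _ (phiW _ Ww).
have [d [z [sz uE]]] := consP _ (phiW _ Wu).
have a0 : a != 0.
  by apply/eqP => a0; apply: Nw; split=> //; rewrite wE a0 scale0r add0r.
have : span t (u - (d / a) *: w).
  apply/W't; split; first by apply: subspaceB => //; apply: WZ.
  rewrite linearB linearZ /= uE wE scalerDr scalerA divfK // opprD addrACA subrr add0r.
  by apply: subspaceB => //; [exact: span_subspace | exact: spanZ].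
move=> tu; rewrite -[u](subrK ((d / a) *: w)); apply: spanD.
  apply: (span_sub (span_subspace _)) tu => x xt.
  by apply: mem_span; rewrite inE xt orbT.
by apply/spanZ/mem_span; rewrite inE eqxx.
Qed.

(** This is what produces vectors satisfying finitely many conditions at once.
    The membership is [List.In] because {linear M -> M} has no decidable
    equality. *)
Lemma infinite_dim_kernel W E (phis : seq {linear M -> M}) :
  subspace W -> infinite_dim W -> fin_dim E ->
  (forall phi : {linear M -> M}, List.In phi phis -> forall u, W u -> E (phi u)) ->
  infinite_dim [set u | W u /\ forall phi : {linear M -> M}, List.In phi phis -> phi u = 0].
Proof.
move=> subW infW /fin_dimP[b bE Eb].
elim: phis => [|phi phis IH] phisW.
  suff -> : [set u | W u /\ forall phi : {linear M -> M}, List.In phi [::] -> phi u = 0] = W by [].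
  by apply/seteqP; split=> [u []|u Wu].
pose K := [set u | W u /\ forall psi : {linear M -> M}, List.In psi phis -> psi u = 0].
have subK : subspace K.
  have [W0 WD WZ] := subW.
  split=> [|u v [Wu u0] [Wv v0]|a u [Wu u0]].
  - by split=> // psi _; rewrite linear0.
  - by split=> [|psi psiP]; [exact: WD | rewrite linearD u0 ?v0 ?addr0].
  - by split=> [|psi psiP]; [exact: WZ | rewrite linearZ /= u0 ?scaler0].
have infK : infinite_dim K by apply: IH => psi psiP; apply: phisW; right.
move=> finK'; apply: infK; apply: (fin_dim_kernel (phi := phi) (s := b) subK).
  by move=> u [Wu _]; apply/Eb/phisW => //; left.
suff -> : [set u | K u /\ phi u = 0] = [set u | W u /\
  forall psi : {linear M -> M}, List.In psi (phi :: phis) -> psi u = 0] by [].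
apply/seteqP; split=> [u [[Wu u0] phiu]|u [Wu u0]].
  by split=> // psi [<-|/u0].
split; last by apply: u0; left.
by split=> // psi psiP; apply: u0; right.
Qed.

End LinearAlgebra.

(** * Virasoro and Heisenberg-Virasoro operators *)

Section Operators.
Variables (F : numFieldType) (M : lmodType F).

(** The scalar [virz] is one twelfth of the central charge, which keeps the
    relations free of denominators. *)
Record virOp := VirOp {
  virL :> int -> {linear M -> M};
  virz : F;
  virLL : forall n m u, virL n (virL m u) =
    virL m (virL n u) + (m - n)%:~R *: virL (n + m) u
    + ((n == - m)%:R * (n ^+ 3 - n)%:~R * virz) *: u }.

(** The cocycle of [L_n, I_m] is allowed two parameters: in the algebra itself
    p = q, but mirroring sends (p, q) to (- p, q), so only the more general
    relations are symmetric. *)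
Record hvOp := HVOp {
  hvL :> virOp;
  hvI : int -> {linear M -> M};
  hvp : F; hvq : F; hve : F; hvh : F;
  hvLI : forall n m u, hvL n (hvI m u) =
    hvI m (hvL n u) + m%:~R *: hvI (n + m) u
    + ((n == - m)%:R * ((n ^+ 2)%:~R * hvp + n%:~R * hvq)) *: u;
  hvII : forall n m u, hvI n (hvI m u) =
    hvI m (hvI n u) + (n%:~R * (n == - m)%:R * hve) *: u;
  hvI0 : forall u, hvI 0 u = hvh *: u }.

Definition mirror_fun (L : int -> {linear M -> M}) (n : int) : {linear M -> M} :=
  \- L (- n).

(** L_n |-> - L_(-n) preserves the Virasoro relations, the central charge being
    negated; it exchanges highest and lowest weight vectors. *)
Lemma vir_mirror_subproof (V : virOp) n m u :
  mirror_fun V n (mirror_fun V m u) =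
  mirror_fun V m (mirror_fun V n u) + (m - n)%:~R *: mirror_fun V (n + m) u
  + ((n == - m)%:R * (n ^+ 3 - n)%:~R * (- virz V)) *: u.
Proof.
rewrite /mirror_fun /= !linearN /= !opprK [LHS]virLL opprD eqr_opp.
have -> : - m - - n = n - m by rewrite opprK addrC.
have -> : (- n) ^+ 3 - - n = - (n ^+ 3 - n) by ring.
vring.
Qed.

Definition vir_mirror (V : virOp) : virOp := VirOp (vir_mirror_subproof V).

Section HVMirror.
Variable A : hvOp.

Lemma hv_mirror_LI n m u :
  vir_mirror A n (hvI A (- m) u) =
  hvI A (- m) (vir_mirror A n u) + m%:~R *: hvI A (- (n + m)) u
  + ((n == - m)%:R * ((n ^+ 2)%:~R * - hvp A + n%:~R * hvq A)) *: u.
Proof.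
rewrite /= /mirror_fun /= !linearN /= hvLI eqr_opp sqrrN.
have -> : - n - m = - (n + m) by rewrite opprD.
vring.
Qed.

Lemma hv_mirror_II n m u :
  hvI A (- n) (hvI A (- m) u) = hvI A (- m) (hvI A (- n) u)
  + (n%:~R * (n == - m)%:R * - hve A) *: u.
Proof. rewrite hvII eqr_opp; vring. Qed.

Lemma hv_mirror_I0 u : hvI A (- 0) u = hvh A *: u.
Proof. by rewrite oppr0 hvI0. Qed.

Definition hv_mirror : hvOp :=
  HVOp hv_mirror_LI hv_mirror_II hv_mirror_I0.

End HVMirror.

Section VirTheory.
Variable V : virOp.

(** Bracket of two modes that do not add up to zero, with the numerical side
    condition in a form that is closed by computation. *)
Lemma virC n m k d u : [&& n + m == k, m - n == d & k != 0] ->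
  V n (V m u) = V m (V n u) + d%:~R *: V k u.
Proof.
case/and3P=> /eqP <- /eqP <-; rewrite addr_eq0 virLL => /negPf ->.
by rewrite !mul0r scale0r addr0.
Qed.

Lemma virC1 u : V 1 (V (-1) u) = V (-1) (V 1 u) - 2 *: V 0 u.
Proof. rewrite virLL /= subrr !mulr0 mul0r; vring. Qed.

Lemma virC2 u :
  V 2 (V (-2) u) = V (-2) (V 2 u) - 4 *: V 0 u + (6 * virz V) *: u.
Proof. rewrite virLL /=; vring. Qed.

Lemma virL0E u : 2 *: V 0 u = V (-1) (V 1 u) - V 1 (V (-1) u).
Proof. rewrite virC1; vring. Qed.

Lemma virL0_weight n z u : V 0 u = z *: u -> V 0 (V n u) = (z + n%:~R) *: V n u.
Proof.
move=> uz; rewrite virLL uz linearZ /= eq_sym oppr_eq0 add0r subr0.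
by case: eqP => [->|_]; vring.
Qed.

End VirTheory.

End Operators.

(** * Submodules and eigenvalues of L_0 *)

Section Generation.
Variables (F : numFieldType) (M : lmodType F).
Implicit Types (A : hvOp M) (V : virOp M) (W : set M).

Definition weight_sp V (z : F) : set M := [set u | V 0 u = z *: u].

Lemma weight_sp_subspace V z : subspace (weight_sp V z).
Proof.
split=> [|u v uz vz|a u uz]; rewrite /weight_sp /=.
- by rewrite linear0 scaler0.
- by rewrite linearD uz vz scalerDr.
- by rewrite linearZ /= uz !scalerA mulrC.
Qed.

Definition stable_under W (f : M -> M) := forall u, W u -> W (f u).

Definition pos_stable A W :=
  [/\ stable_under W (A 1), stable_under W (A 2) & stable_under W (hvI A 1)].

Definition hv_irr A := forall W, subspace W ->
  (forall n, stable_under W (A n)) -> (forall n, stable_under W (hvI A n)) ->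
  (exists2 u, W u & u != 0) -> forall u, W u.

Lemma subspace_scale W (a : F) u : subspace W -> a != 0 -> W (a *: u) -> W u.
Proof.
by case=> _ _ WZ a0 /(WZ a^-1); rewrite scalerA mulVf // scale1r.
Qed.

(** L_1, L_2 and I_1 generate the positive part of the algebra, as
    [L_1, L_n] = (n - 1) L_(n+1) and [L_1, I_n] = n I_(n+1). *)
Lemma pos_stable_all A W : subspace W -> pos_stable A W ->
  forall n : nat, stable_under W (A n.+1) /\ stable_under W (hvI A n.+1).
Proof.
move=> subW [W1 W2 WI]; elim=> [//|n [IHL IHI]]; split=> u Wu.
- case: n IHL {IHI} => [_|n IHL]; first exact: W2.
  apply: (@subspace_scale W n.+1%:R) => //; first by rewrite pnatr_eq0.
  have -> : n.+1%:R *: A n.+3 u = A 1 (A n.+2 u) - A n.+2 (A 1 u).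
    rewrite (@virC _ _ A 1 n.+2 n.+3 n.+1) //.
      by rewrite [X in X - _]addrC addrK.
    by apply/and3P; split=> //; lia.
  by apply: subspaceB; auto.
- apply: (@subspace_scale W n.+1%:R) => //; first by rewrite pnatr_eq0.
  have -> : n.+1%:R *: hvI A n.+2 u = A 1 (hvI A n.+1 u) - hvI A n.+1 (A 1 u).
    rewrite hvLI (_ : (1 == - _) = false) ?mul0r ?scale0r ?addr0; last by lia.
    by rewrite [X in X - _]addrC addrK.
  by apply: subspaceB; auto.
Qed.

(** Irreducibility only has to be tested on six generators; L_0 comes from
    [L_1, L_(-1)], and I_0 is a scalar. *)
Lemma gen_stable_full A W : hv_irr A -> subspace W ->
  pos_stable A W -> pos_stable (hv_mirror A) W ->
  (exists2 u, W u & u != 0) -> forall u, W u.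
Proof.
move=> irrA subW posW negW; have [W0 WD WZ] := subW.
have posA := pos_stable_all subW posW.
have negA (n : nat) :
    stable_under W (A (Negz n)) /\ stable_under W (hvI A (Negz n)).
  have [WL WI] := pos_stable_all subW negW n.
  split=> u Wu; last exact: WI.
  by rewrite -[A _ u]opprK -scaleN1r; apply/WZ/WL.
apply: irrA => // [] [[|n]|n]; try by case: (posA n); case: (negA n).
- move=> u Wu; apply: (@subspace_scale W 2) => //; first by rewrite pnatr_eq0.
  change (W (2 *: A 0 u)); rewrite virL0E; apply: subspaceB => //.
    by case: (negA 0) => + _; apply; case: (posA 0) => + _; apply.
  by case: (posA 0) => + _; apply; case: (negA 0) => + _; apply.
- by move=> u Wu; rewrite hvI0; apply: WZ.
Qed.

Definition kill V (t : seq F) (u : M) : M :=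
  foldr (fun z w => V 0 w - z *: w) u t.

Lemma kill_cat V t1 t2 u : kill V (t1 ++ t2) u = kill V t1 (kill V t2 u).
Proof. exact: foldr_cat. Qed.

Lemma killD V t u v : kill V t (u + v) = kill V t u + kill V t v.
Proof.
elim: t => //= z t ->; rewrite linearD; vring.
Qed.

Lemma killZ V t a u : kill V t (a *: u) = a *: kill V t u.
Proof. elim: t => //= z t ->; rewrite linearZ /=; vring. Qed.

Lemma kill0 V t : kill V t 0 = 0.
Proof. by elim: t => //= z t ->; rewrite linear0 scaler0 subrr. Qed.

Lemma killC V t1 t2 u : kill V t1 (kill V t2 u) = kill V t2 (kill V t1 u).
Proof.
have kill1C z t v : kill V [:: z] (kill V t v) = kill V t (kill V [:: z] v).
  elim: t => //= y t <- /=; rewrite !linearB !linearZ /=; vring.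
elim: t1 t2 u => //= z t IH t2 u.
by rewrite IH; exact: (kill1C z t2 (kill V t u)).
Qed.

Lemma kill_weight V t u z : V 0 u = z *: u ->
  kill V t u = (\prod_(y <- t) (z - y)) *: u.
Proof.
move=> uz; elim: t => [|y t IH] /=; first by rewrite big_nil scale1r.
rewrite IH big_cons linearZ /= uz; vring.
Qed.

Lemma kill_weight_eq0 V t u z : V 0 u = z *: u -> kill V t u = 0 -> u != 0 ->
  z \in t.
Proof.
move=> /kill_weight-> /eqP; rewrite scaler_eq0 => /orP[|/eqP->]; last by rewrite eqxx.
by rewrite prodf_seq_eq0 => /hasP[y yt]; rewrite /= subr_eq0 => /eqP->.
Qed.

End Generation.

Lemma hvI_weight (F : numFieldType) (M : lmodType F) (A : hvOp M) n z u :
  A 0 u = z *: u -> A 0 (hvI A n u) = (z + n%:~R) *: hvI A n u.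
Proof. move=> uz; rewrite hvLI uz linearZ /= add0r; vring. Qed.

(** * Submodules with finite-dimensional weight spaces *)

Section Graded.
Variables (F : numFieldType) (M : lmodType F) (A : hvOp M).
Hypothesis irrA : hv_irr A.

Section Family.
Variables (J : Type) (B : J -> seq M) (wt : J -> F).

Definition graded_stable (f : M -> M) :=
  forall j b, b \in B j -> exists j', span (B j') (f b).

Definition pos_graded_stable (A' : hvOp M) :=
  [/\ graded_stable (A' 1), graded_stable (A' 2) & graded_stable (hvI A' 1)].

(** The spans of the sequences [B j] together span a submodule, hence M.  A
    vector of weight z is then a sum of a vector in the only [span (B j)] of
    weight z and of vectors killed by a product of factors L_0 - y with y <> z,
    and the latter sum, being of weight z too, vanishes. *)
Lemma graded_fin_dim :
  injective wt -> (forall j b, b \in B j -> A 0 b = wt j *: b) ->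
  pos_graded_stable A -> pos_graded_stable (hv_mirror A) ->
  (exists j, exists2 b, b \in B j & b != 0) ->
  forall z, fin_dim (weight_sp A z).
Proof.
move=> wt_inj Bwt posB negB [j0 [b0 Bb0 b0_neq0]] z.
pose hom (w : M) := exists j, span (B j) w.
pose W : set M := [set u | exists2 s, (forall w, w \in s -> hom w) & u = \sum_(w <- s) w].
have homZ a w : hom w -> hom (a *: w) by case=> j jw; exists j; exact: spanZ.
have subW : subspace W.
  split=> [|u v [s sh ->] [t th ->]|a u [s sh ->]].
  - by exists [::]; rewrite ?big_nil.
  - exists (s ++ t); rewrite ?big_cat // => w.
    by rewrite mem_cat => /orP[/sh|/th].
  - exists [seq a *: w | w <- s]; last by rewrite big_map scaler_sumr.
    by move=> _ /mapP[w /sh wh ->]; apply: homZ.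
have homW w : hom w -> W w.
  move=> wh; exists [:: w]; last by rewrite big_seq1.
  by move=> x; rewrite inE => /eqP->.
have stableW (f : {linear M -> M}) : graded_stable f -> stable_under W f.
  move=> fB _ [s sh ->]; rewrite linear_sum big_seq.
  apply: subspace_sum => // w /sh [j] jw.
  pose W' : set M := [set u | W (f u)].
  apply: (@span_sub _ _ W' (B j)) jw => [|b /fB [j' j'b]]; last by apply: homW; exists j'.
  have [W0 WD WZ] := subW.
  split=> [|u v|a u]; rewrite /W' /= ?linear0 ?linearD ?linearZ //=; auto.
have WT : forall u, W u.
  case: posB negB => P1 P2 P3 [N1 N2 N3].
  apply: (gen_stable_full irrA) => //; try by split; apply: stableW.
  exists b0 => //; apply: homW; exists j0; exact: mem_span.
have homwt j w : span (B j) w -> A 0 w = wt j *: w.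
  by apply: (@span_sub _ _ (weight_sp A (wt j))); [exact: weight_sp_subspace | exact: Bwt].
(* empty when z is not a value of wt, so that both cases are treated at once *)
pose Bz := if pselect (exists j, wt j = z) is left P then B (projT1 (cid P)) else [::].
have Bzwt b : b \in Bz -> weight_sp A z b.
  rewrite /Bz; case: pselect => // P; case: (cid P) => j /= <-; exact: Bwt.
apply: (@fin_dim_span _ _ _ Bz) => // u uz.
have [s sh uE] := WT u.
have [u1 [u2 [t [u12 u1z tu2 zt]]]] : exists u1 u2 t,
    [/\ u = u1 + u2, span Bz u1, kill A t u2 = 0 & z \notin t].
  rewrite uE; elim: s sh {uE} => [_|w s IH sh].
    by exists 0, 0, [::]; rewrite big_nil addr0; split=> //; exact: span0.
  have [|u1 [u2 [t [sE u1z tu2 zt]]]] := IH.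
    by move=> x xs; apply: sh; rewrite inE xs orbT.
  have [j jw] : hom w by apply: sh; rewrite inE eqxx.
  rewrite big_cons sE; have [wtj|wtj] := eqVneq (wt j) z.
    exists (w + u1), u2, t; rewrite addrA; split=> //; apply: spanD => //.
    rewrite /Bz; case: pselect => [P|[]]; last by exists j.
    case: (cid P) => j' /= wtj'.
    by rewrite (wt_inj j' j) // wtj' wtj.
  exists u1, (w + u2), (wt j :: t); split=> //.
  - by rewrite addrCA.
  - rewrite -cat1s kill_cat killD tu2 addr0 killC /= (homwt _ _ jw) subrr.
    exact: kill0.
  - by rewrite inE eq_sym negb_or wtj.
have u2z : weight_sp A z u2.
  rewrite (_ : u2 = u - u1); last by rewrite u12 addrAC subrr add0r.
  apply: subspaceB => //; first exact: weight_sp_subspace.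
  by apply: (span_sub (weight_sp_subspace A z)) u1z.
rewrite u12 (_ : u2 = 0) ?addr0 //; apply: contrapT => /eqP u2_neq0.
by rewrite (kill_weight_eq0 u2z tu2 u2_neq0) in zt.
Qed.

End Family.

Variables (v : M) (z : F).
Hypotheses (v_neq0 : v != 0) (vz : A 0 v = z *: v).
Hypotheses (L1v : A 1 v = 0) (L2v : A 2 v = 0) (I1v : hvI A 1 v = 0).

(** The words in L_(-1), I_(-1), L_(-2) applied to v, the term of index n + 2
    collecting those of degree - n.  Starting at index 2, below two empty
    sequences, makes the recursion uniform. *)
Fixpoint hw_span (n : nat) : seq M :=
  match n with
  | (((k.+1 as k1).+1 as k2).+1) =>
    map (A (-1)) (hw_span k2) ++ map (hvI A (-1)) (hw_span k2)
      ++ map (A (-2)) (hw_span k1)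
  | 2 => [:: v]
  | _ => [::]
  end.

Arguments hw_span : simpl never.

Lemma hw_spanS n : hw_span n.+3 =
  map (A (-1)) (hw_span n.+2) ++ map (hvI A (-1)) (hw_span n.+2)
  ++ map (A (-2)) (hw_span n.+1).
Proof. by []. Qed.

Lemma hw_span_ind (P : nat -> M -> Prop) :
  P 2%N v ->
  (forall n b, b \in hw_span n.+2 -> P n.+2 b -> P n.+3 (A (-1) b)) ->
  (forall n b, b \in hw_span n.+2 -> P n.+2 b -> P n.+3 (hvI A (-1) b)) ->
  (forall n b, b \in hw_span n.+1 -> P n.+1 b -> P n.+3 (A (-2) b)) ->
  forall n b, b \in hw_span n -> P n b.
Proof.
move=> P0 PL1 PI PL2; elim/ltn_ind=> -[|[|[|n]]] IH b //.
  by rewrite inE => /eqP->.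
rewrite hw_spanS !mem_cat => /or3P[] /mapP[x xn ->].
- by apply: PL1 => //; apply: IH.
- by apply: PI => //; apply: IH.
- by apply: PL2 => //; apply: IH.
Qed.

Lemma hw_span_neg n b : b \in hw_span n ->
  [/\ b \in hw_span n, A (-1) b \in hw_span n.+1,
      hvI A (-1) b \in hw_span n.+1 & A (-2) b \in hw_span n.+2].
Proof.
case: n => [|n] // bn; split=> //.
- by case: n bn => // n bn; rewrite hw_spanS mem_cat map_f.
- by case: n bn => // n bn; rewrite hw_spanS !mem_cat map_f ?orbT.
- by rewrite hw_spanS !mem_cat map_f ?orbT.
Qed.

Lemma hw_span_weight n b : b \in hw_span n -> A 0 b = (z + 2 - n%:R) *: b.
Proof.
apply: (@hw_span_ind (fun n b => A 0 b = (z + 2 - n%:R) *: b)) => {n b}.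
- by rewrite vz addrK.
- move=> n b _ bz; rewrite (virL0_weight _ bz); congr (_ *: _).
  by rewrite -[n.+3]addn3 -[n.+2]addn2 !natrD; ring.
- move=> n b _ bz; rewrite (hvI_weight _ bz); congr (_ *: _).
  by rewrite -[n.+3]addn3 -[n.+2]addn2 !natrD; ring.
- move=> n b _ bz; rewrite (virL0_weight _ bz); congr (_ *: _).
  by rewrite -[n.+3]addn3 -[n.+1]addn1 !natrD; ring.
Qed.

Lemma hw_span_up (f : {linear M -> M}) m n u :
  (forall n b, b \in hw_span n -> f b \in hw_span (m + n)) ->
  span (hw_span n) u -> span (hw_span (m + n)) (f u).
Proof. by move=> fB; apply: span_img => b /fB fb; apply: mem_span. Qed.

Lemma hw_span_upL1 n u : span (hw_span n) u -> span (hw_span n.+1) (A (-1) u).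
Proof. by apply: (@hw_span_up (A (-1)) 1) => {}n b /hw_span_neg[]. Qed.

Lemma hw_span_upI1 n u : span (hw_span n) u -> span (hw_span n.+1) (hvI A (-1) u).
Proof. by apply: (@hw_span_up (hvI A (-1)) 1) => {}n b /hw_span_neg[]. Qed.

Lemma hw_span_upL2 n u : span (hw_span n) u -> span (hw_span n.+2) (A (-2) u).
Proof. by apply: (@hw_span_up (A (-2)) 2) => {}n b /hw_span_neg[]. Qed.

(** Moving L_1, L_2 or I_1 to the right through a word only creates shorter
    words, since the brackets with L_(-1), I_(-1), L_(-2) are spanned by
    the six generators, L_0 and scalars. *)
Lemma hw_span_down n b : b \in hw_span n ->
  [/\ span (hw_span n.-1) (A 1 b), span (hw_span n.-2) (A 2 b)
    & span (hw_span n.-1) (hvI A 1 b)].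
Proof.
apply: (@hw_span_ind (fun n b => [/\ span (hw_span n.-1) (A 1 b),
  span (hw_span n.-2) (A 2 b) & span (hw_span n.-1) (hvI A 1 b)])) => {n b}.
- by rewrite L1v L2v I1v; split; exact: span0.
- move=> n b bn [/= b1 b2 bI]; have sb := mem_span bn; split=> /=.
  + rewrite virC1 (hw_span_weight bn); apply: spanB; first exact: hw_span_upL1.
    exact/spanZ/spanZ.
  + rewrite (@virC _ _ A 2 (-1) 1 (-3)) //; apply: spanD; first exact: hw_span_upL1.
    exact: spanZ.
  + have -> : hvI A 1 (A (-1) b) = A (-1) (hvI A 1 b)
        - (hvh A + hvp A - hvq A) *: b.
      rewrite hvLI /= hvI0; vring.
    by apply: spanB; [exact: hw_span_upL1 | exact: spanZ].
- move=> n b bn [/= b1 b2 bI]; have sb := mem_span bn; split=> /=.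
  + rewrite hvLI /= hvI0; apply: spanD; last exact: spanZ.
    by apply: spanD; [exact: hw_span_upI1 | do 2!apply: spanZ].
  + rewrite hvLI /= mul0r scale0r addr0; apply: spanD; first exact: hw_span_upI1.
    exact: spanZ.
  + by rewrite hvII; apply: spanD; [exact: hw_span_upI1 | exact: spanZ].
- case=> [//|n] b bn [/= b1 b2 bI]; have sb := mem_span bn.
  have [_ /mem_span sL1b /mem_span sI1b _] := hw_span_neg bn.
  split=> /=.
  + rewrite (@virC _ _ A 1 (-2) (-1) (-3)) //; apply: spanD; first exact: hw_span_upL2.
    exact: spanZ.
  + rewrite virC2 (hw_span_weight bn); apply: spanD; last exact: spanZ.
    by apply: spanB; [exact: hw_span_upL2 | exact/spanZ/spanZ].
  + have -> : hvI A 1 (A (-2) b) = A (-2) (hvI A 1 b) - hvI A (-1) b.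
      rewrite hvLI /=; vring.
    by apply: spanB; first exact: hw_span_upL2.
Qed.

(** The words above span a submodule, by [hw_span_neg] and [hw_span_down], and there are
    finitely many of them in each degree. *)
Lemma hw_fin_dim y : fin_dim (weight_sp A y).
Proof.
apply: (@graded_fin_dim nat hw_span (fun n => z + 2 - n%:R)) => [m n||||].
- by move/addrI/oppr_inj/eqP; rewrite eqr_nat => /eqP.
- exact: hw_span_weight.
- by split=> n b /hw_span_down[]; [exists n.-1 | exists n.-2 | exists n.-1].
- split=> n b /hw_span_neg[_ /mem_span L1b /mem_span I1b /mem_span L2b].
  + exists n.+1; rewrite /= /mirror_fun /= -scaleN1r; exact: spanZ.
  + exists n.+2; rewrite /= /mirror_fun /= -scaleN1r; exact: spanZ.
  + by exists n.+1.
- by exists 2%N; exists v => //; rewrite inE.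
Qed.

End Graded.

(** * Vectors next to a finite-dimensional weight space *)

Section Virasoro.
Variables (F : numFieldType) (M : lmodType F).
Implicit Types (V : virOp M) (u v w : M).

Definition no_hw V := forall z u, V 0 u = z *: u -> V 1 u = 0 -> V 2 u = 0 -> u = 0.

Definition lower2raise2 V u := V (-2) (V 2 u).

(** All conditions are of the form x v = 0 with x of degree 1: they can be
    imposed on a vector v whose weight is just below a finite-dimensional weight
    space. *)
Definition half_gap_vector V v := [/\ V 1 v = 0, V 2 (V (-1) v) = 0,
  V (-2) (V 3 v) = 0, V 1 (lower2raise2 V v) = 0 & V 2 (V (-1) (lower2raise2 V v)) = 0].

Lemma vir3 V u : V 1 u = 0 -> V 3 u = V 1 (V 2 u).
Proof. by move=> u1; rewrite (@virC _ _ V 1 2 3 1) // u1 linear0 add0r scale1r. Qed.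

(** The bracket relations [L_1, L_3] = 2 L_4 and [L_1, L_4] = 3 L_5. *)
Lemma vir_odd_tail V u : V 1 u = 0 -> V 3 u = 0 -> V 5 u = 0.
Proof.
move=> u1 u3; have u4 : V 4 u = 0.
  have := @virC _ _ V 1 3 4 2 u isT; rewrite u1 u3 !linear0 add0r => /esym/eqP.
  by rewrite scaler_eq0 intr_eq0 => /eqP.
have := @virC _ _ V 1 4 5 3 u isT; rewrite u1 u4 !linear0 add0r => /esym/eqP.
by rewrite scaler_eq0 intr_eq0 => /eqP.
Qed.

Lemma Lm1L2_eq0 V v : V 1 v = 0 -> V 2 (V (-1) v) = 0 -> V (-1) (V 2 v) = 0.
Proof.
by move=> v1; rewrite (@virC _ _ V 2 (-1) 1 (-3)) // v1 scaler0 addr0.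
Qed.

Section HalfRelations.
Variables (V : virOp M) (a : F) (v : M).
Hypotheses (noHW : no_hw V) (va : V 0 v = (a - 1) *: v) (gapv : half_gap_vector V v).

Let x := V (-1) v.
Let w := V 2 v.
Let v' := lower2raise2 V v.

Let L1v : V 1 v = 0. Proof. by case: gapv. Qed.
Let L2x : V 2 x = 0. Proof. by case: gapv. Qed.
Let L1v' : V 1 v' = 0. Proof. by case: gapv. Qed.
Let L2x' : V 2 (V (-1) v') = 0. Proof. by case: gapv. Qed.

Let xa : V 0 x = (a - 2) *: x.
Proof. rewrite (virL0_weight _ va); vring. Qed.
Let v'a : V 0 v' = (a - 1) *: v'.
Proof. rewrite (virL0_weight _ (virL0_weight _ va)); vring. Qed.

Lemma virL1x : V 1 x = (2 - 2 * a) *: v.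
Proof. rewrite virC1 L1v va linear0; vring. Qed.

Let Lm1w : V (-1) w = 0.
Proof. exact: Lm1L2_eq0. Qed.

Lemma virL3x : V 3 x = (2 * a - 2) *: w.
Proof.
have := @virC _ _ V 1 2 3 1 x isT; rewrite L2x virL1x linear0 linearZ /=.
move=> /esym/eqP; rewrite addrC addr_eq0 => /eqP.
rewrite scale1r => ->; vring.
Qed.

(* the combination of the two vectors of this degree that L_1 kills *)
Let r := (4 * a - 6) *: V (-2) v - 3 *: V (-1) x.

Let ra : V 0 r = (a - 3) *: r.
Proof.
rewrite linearB !linearZ /= (virL0_weight _ va) (virL0_weight _ xa); vring.
Qed.

Let L1r : V 1 r = 0.
Proof.
rewrite linearB !linearZ /= (@virC _ _ V 1 (-2) (-1) (-3)) // L1v linear0.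
rewrite virC1 virL1x xa linearZ /=; vring.
Qed.

Let L3r : V 3 r = 0.
Proof.
rewrite linearB !linearZ /= (@virC _ _ V 3 (-2) 1 (-5)) // L1v.
rewrite (@virC _ _ V 3 (-1) 2 (-4)) // L2x virL3x linearZ /= Lm1w.
case: gapv => _ _ -> _ _; vring.
Qed.

Let s := V 2 r.
(* s = 0 makes v an eigenvector of L_(-2) L_2, with eigenvalue
   kappa / (4 a - 6) *)
Let kappa := 18 * (a - 1) + (4 * a - 6) * (4 * (a - 1) - 6 * virz V).

Let sE : s = (4 * a - 6) *: v' - kappa *: v.
Proof.
rewrite /s linearB !linearZ /= virC2 va.
rewrite (@virC _ _ V 2 (-1) 1 (-3)) // L2x virL1x linear0 -/(lower2raise2 V v) -/v' /kappa.
vring.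
Qed.

Let sa : V 0 s = (a - 1) *: s.
Proof. rewrite (virL0_weight _ ra); vring. Qed.

Let L1s : V 1 s = 0.
Proof. rewrite sE linearB !linearZ /= L1v L1v'; vring. Qed.

Let L2xs : V 2 (V (-1) s) = 0.
Proof. rewrite sE !linearB !linearZ /= -/x L2x L2x'; vring. Qed.

Let L3s : V 3 s = 0.
Proof.
rewrite /s (@virC _ _ V 3 2 5 (-1)) // (vir_odd_tail L1r L3r) L3r linear0; vring.
Qed.

(** L_2 s is killed by L_1 and by L_(-1), hence by L_0; its weight a + 1 being
    nonzero, it vanishes.  So s is a highest weight vector unless it is zero, and
    then the same holds for r. *)
Lemma half_relations : a + 1 != 0 -> r = 0 /\ (4 * a - 6) *: v' = kappa *: v.
Proof.
move=> a1; have L12s : V 1 (V 2 s) = 0 by rewrite -vir3.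
have Lm12s := Lm1L2_eq0 L1s L2xs.
have L2s : V 2 s = 0.
  apply/eqP; have /eqP := virL0E V (V 2 s).
  rewrite L12s Lm12s !linear0 ?(subr0, addr0) (virL0_weight _ sa) !scaler_eq0 pnatr_eq0 /=.
  by rewrite (_ : a - 1 + _ = a + 1) ?(negPf a1) //; ring.
have s0 : s = 0 by apply: noHW sa L1s L2s.
split; first exact: noHW ra L1r s0.
by apply/eqP; rewrite -subr_eq0 -sE s0.
Qed.

End HalfRelations.

Section SecondRelation.
Variables (V : virOp M) (a tau : F) (v : M).
Hypotheses (va : V 0 v = (a - 1) *: v) (gapv : half_gap_vector V v).
Hypotheses (a1 : a - 1 != 0) (w_neq0 : V 2 v != 0).
Hypothesis r0 : (4 * a - 6) *: V (-2) v = 3 *: V (-1) (V (-1) v).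
Hypothesis Tv : lower2raise2 V v = tau *: v.

Let x := V (-1) v.
Let y := V (-1) x.
Let w := V 2 v.

Let L1v : V 1 v = 0. Proof. by case: gapv. Qed.
Let L2x : V 2 x = 0. Proof. by case: gapv. Qed.
Let L1x : V 1 x = (2 - 2 * a) *: v. Proof. exact: virL1x. Qed.
Let xa : V 0 x = (a - 2) *: x.
Proof. rewrite (virL0_weight _ va); vring. Qed.
Let ya : V 0 y = (a - 3) *: y.
Proof. rewrite (virL0_weight _ xa); vring. Qed.
Let L1y : V 1 y = (6 - 4 * a) *: x.
Proof. rewrite virC1 L1x xa linearZ /= -/x; vring. Qed.
Let L2y : V 2 y = (6 * a - 6) *: v.
Proof. rewrite (@virC _ _ V 2 (-1) 1 (-3)) // L2x L1x linear0; vring. Qed.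

Let Lm3w : V (-3) w = - tau *: x.
Proof.
have := @virC _ _ V (-1) (-2) (-3) (-1) w isT.
rewrite (Lm1L2_eq0 L1v L2x) linear0 -/(lower2raise2 V v) Tv linearZ /= add0r => /eqP.
by rewrite mulrN1z scaleN1r -eqr_oppLR => /eqP <-; rewrite scaleNr.
Qed.

(* again the combination that L_1 kills, now one degree lower *)
Let r := ((6 * a - 12) * (4 * a - 6)) *: V (-3) v - 12 *: V (-1) y.
Let rho := (6 * a - 12) * (4 * a - 6) * (5 + tau) + 12 * (18 * a - 24).

Let L1r : V 1 r = 0.
Proof.
rewrite linearB !linearZ /= (@virC _ _ V 1 (-3) (-2) (-4)) // L1v linear0.
rewrite virC1 L1y linearZ /= -/y ya.
transitivity ((-4 * (6 * a - 12)) *: ((4 * a - 6) *: V (-2) v - 3 *: y)).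
  vring.
by rewrite r0 subrr scaler0.
Qed.

Let L2r : V 2 r = - rho *: x.
Proof.
rewrite linearB !linearZ /= (@virC _ _ V 2 (-3) (-1) (-5)) // -/w Lm3w.
rewrite (@virC _ _ V 2 (-1) 1 (-3)) // L2y L1y linearZ /= -/x /rho; vring.
Qed.

Let L3r : V 3 r = (rho * (2 * a - 2)) *: v.
Proof. rewrite vir3 // L2r linearZ /= L1x; vring. Qed.

Let L5r : V 5 r = 0.
Proof.
have L4r : V 4 r = 0.
  have := @virC _ _ V 1 3 4 2 r isT.
  rewrite L1r L3r linearZ /= L1v !linear0 add0r => /esym/eqP.
  by rewrite scaler_eq0 intr_eq0 => /eqP.
have := @virC _ _ V 1 4 5 3 r isT; rewrite L1r L4r !linear0 add0r => /esym/eqP.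
by rewrite scaler_eq0 intr_eq0 => /eqP.
Qed.

(** Here L_2 r is a multiple of L_(-1) v, not zero a priori; but L_5 r can be
    computed both from [L_1, L_4] and from [L_2, L_3], and the two results agree
    only if the factor rho of that multiple vanishes. *)
Lemma second_relation : (a - 2) * (2 * a - 3) * (5 + tau) + 6 * (3 * a - 4) = 0.
Proof.
have := @virC _ _ V 2 3 5 1 r isT; rewrite L5r L2r L3r !linearZ /= -/w.
rewrite (virL3x va gapv) -/w => /eqP. rewrite scaler0 addr0 scalerA -subr_eq0 -scalerBl.
rewrite scaler_eq0 (negPf w_neq0) orbF => /eqP rho0.
have {rho0} : rho * (a - 1) = 0.
  apply/eqP; rewrite -(mulrI_eq0 _ (lregP (_ : 4 != 0))) ?pnatr_eq0 //.
  by rewrite -rho0; apply/eqP; ring.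
move/eqP; rewrite mulf_eq0 (negPf a1) orbF => rho0.
apply/eqP; rewrite -(mulrI_eq0 _ (lregP (_ : 12 != 0))) ?pnatr_eq0 //.
by rewrite -(eqP rho0) /rho; apply/eqP; ring.
Qed.

End SecondRelation.

(** The two further conditions make L_2 v satisfy the mirrored conditions. *)
Definition gap_vector V v := [/\ half_gap_vector V v, V 2 (V (-3) (V 2 v)) = 0
  & V (-2) (V 3 (lower2raise2 V v)) = 0].

Lemma vir_mirrorE V n u : vir_mirror V n u = - V (- n) u.
Proof. by []. Qed.

Lemma mirror_weight V z u : V 0 u = z *: u -> vir_mirror V 0 u = (- z) *: u.
Proof. by move=> uz; rewrite vir_mirrorE oppr0 uz scaleNr. Qed.

Lemma mirror_lower2raise2 V v : lower2raise2 (vir_mirror V) (V 2 v) = V 2 (lower2raise2 V v).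
Proof. by rewrite /lower2raise2 !vir_mirrorE !linearN /= !opprK. Qed.

Lemma gap_vector_mirror V v : gap_vector V v -> half_gap_vector (vir_mirror V) (V 2 v).
Proof.
case=> -[v1 v2 v3 v4 v5] v6 v7; rewrite /half_gap_vector mirror_lower2raise2 !vir_mirrorE.
rewrite !linearN /= !opprK -!vir3 // v3 v6 v7 !(Lm1L2_eq0 _ _) //.
by split; rewrite ?oppr0.
Qed.

Section Constants.
Variables (V : virOp M) (a : F) (v : M).
Hypotheses (noHW : no_hw V) (noLW : no_hw (vir_mirror V)).
Hypotheses (v_neq0 : v != 0) (va : V 0 v = (a - 1) *: v).

(** The case a = 1 is excluded because then L_(-1) v is killed by L_1 and
    L_2; and if 4a - 6 vanished, the second conclusion of [half_relations] would
    read 0 = 9 v. *)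
Lemma half_constants : half_gap_vector V v -> a + 1 != 0 ->
  [/\ a - 1 != 0, (4 * a - 6) *: V (-2) v = 3 *: V (-1) (V (-1) v)
    & exists2 tau, lower2raise2 V v = tau *: v &
      (4 * a - 6) * tau = 18 * (a - 1) + (4 * a - 6) * (4 * (a - 1) - 6 * virz V)].
Proof.
move=> gapv a1; have [/eqP r0 T0] := half_relations noHW va gapv a1.
move: r0; rewrite subr_eq0 => /eqP r0.
have [v1 v2 _ _ _] := gapv.
have a6 : 4 * a - 6 != 0.
  apply: contra_neqN v_neq0 => /eqP a6; apply/eqP.
  move: T0; rewrite a6 mul0r addr0 scale0r => /esym/eqP.
  rewrite scaler_eq0 => /orP[|/eqP //].
  rewrite (_ : 18 * (a - 1) = 9 + 9 * ((4 * a - 6) / 2)); last by field.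
  by rewrite a6 mul0r mulr0 addr0 pnatr_eq0.
split=> //; last first.
  exists ((18 * (a - 1) + (4 * a - 6) * (4 * (a - 1) - 6 * virz V)) / (4 * a - 6)).
    by rewrite [_ / _]mulrC -scalerA -T0 scalerA mulVf ?scale1r.
  by rewrite mulrC divfK.
apply: contra_neq v_neq0 => /eqP; rewrite subr_eq0 => /eqP a_1.
have x0 : V (-1) v = 0.
  apply: (noHW (virL0_weight _ va)) => //.
  by rewrite (virL1x va) // a_1 mulr1 subrr scale0r.
apply: (noLW (mirror_weight va)); rewrite vir_mirrorE ?x0 ?oppr0 //.
move: r0; rewrite x0 linear0 scaler0 => /eqP; rewrite scaler_eq0 (negPf a6) /=.
by move=> /eqP ->; rewrite oppr0.
Qed.

End Constants.

(** Eliminating tau and the central charge from the four equations leaves a = 0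
    or a^2 = 5/3; in the latter case the two pairs of equations give the
    different values -17/7 and -37/7 for tau. *)
Lemma constants V a v : no_hw V -> no_hw (vir_mirror V) -> v != 0 ->
  V 0 v = (a - 1) *: v -> gap_vector V v ->
  [/\ V 2 v != 0, a = 0, virz V = 0 & lower2raise2 V v = - v].
Proof.
move=> noHW noLW v0 va gapv; have [hgapv _ _] := gapv.
have hgapw := gap_vector_mirror gapv.
have noHW' : no_hw (vir_mirror (vir_mirror V)).
  move=> z u; rewrite !vir_mirrorE !opprK; exact: noHW.
have w0 : V 2 v != 0.
  by apply: contra_neq v0 => w0; apply: noHW va _ w0; case: hgapv.
have wa : vir_mirror V 0 (V 2 v) = (- a - 1) *: V 2 v.
  rewrite (mirror_weight (virL0_weight _ va)); vring.
have a1 : a + 1 != 0.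
  apply/negP; rewrite addr_eq0 => /eqP aE.
  have [|] := half_constants noLW noHW' w0 wa hgapw.
    by rewrite aE opprK -mulr2n pnatr_eq0.
  by rewrite aE opprK subrr eqxx.
have [a1' r0 [tau Tv E1]] := half_constants noHW noLW v0 va hgapv a1.
have [|_ r0' [tau' Tw E1']] := half_constants noLW noHW' w0 wa hgapw.
  by apply: contra a1'; rewrite addrC -subr_eq0 subr0 subr_eq0 eq_sym subr_eq0.
have tauE : tau' = tau.
  move: Tw; rewrite mirror_lower2raise2 Tv linearZ /= => /eqP.
  by rewrite -subr_eq0 -scalerBl scaler_eq0 (negPf w0) orbF subr_eq0 => /eqP.
rewrite {}tauE in Tw E1'.
have E2 := second_relation va hgapv a1' w0 r0 Tv.
have E2' : (- a - 2) * (2 * - a - 3) * (5 + tau) + 6 * (3 * - a - 4) = 0.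
  apply: (second_relation wa hgapw) r0' Tw.
    by rewrite -opprD oppr_eq0.
  apply: contra_neq w0 => w'0; apply: noLW wa _ w'0.
  by case: hgapw.
have [a0|a_neq0] := eqVneq a 0.
  have tauE : tau = -1.
    apply: (mulfI (_ : 6 != 0)); first by rewrite pnatr_eq0.
    apply/eqP; rewrite -subr_eq0 -E2 a0; apply/eqP; ring.
  split=> //; last by rewrite Tv tauE scaleN1r.
  apply: (mulfI (_ : 36 != 0)); first by rewrite pnatr_eq0.
  move/eqP: E1; rewrite -subr_eq0 a0 tauE mulr0 => /eqP E1.
  rewrite mulr0 -[RHS]oppr0 -E1; ring.
(* difference and sum of the equations E2 and E2' *)
have tauE : 14 * tau = - 34.
  apply: (mulfI a_neq0); apply/eqP; rewrite -subr_eq0.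
  have -> : a * (14 * tau) - a * (- 34)
    = ((- a - 2) * (2 * - a - 3) * (5 + tau) + 6 * (3 * - a - 4))
      - ((a - 2) * (2 * a - 3) * (5 + tau) + 6 * (3 * a - 4)) by ring.
  by rewrite E2 E2' subrr.
have aE : 12 * a ^+ 2 = 20.
  apply: (mulfI (_ : 36 != 0)); first by rewrite pnatr_eq0.
  apply/eqP; rewrite -subr_eq0.
  have -> : 36 * (12 * a ^+ 2) - 36 * 20 =
     42 * (((- a - 2) * (2 * - a - 3) * (5 + tau) + 6 * (3 * - a - 4))
      + ((a - 2) * (2 * a - 3) * (5 + tau) + 6 * (3 * a - 4)))
     - (12 * a ^+ 2 + 36) * (14 * tau + 34) by ring.
  by rewrite E2 E2' tauE addNr addr0 !mulr0 subrr.
exfalso; have : (12 * a ^+ 2 - 27) * (14 * tau + 56) - 63 * (12 * a ^+ 2 - 18) = 0.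
  move/eqP: E1; rewrite -subr_eq0 => /eqP E1.
  move/eqP: E1'; rewrite -subr_eq0 => /eqP E1'.
  apply: (mulfI (_ : 2 != 0)); first by rewrite pnatr_eq0.
  (* this combination of E1 and E1' eliminates the central charge *)
  transitivity (21 * (2 * a + 3) * ((4 * a - 6) * tau
        - (18 * (a - 1) + (4 * a - 6) * (4 * (a - 1) - 6 * virz V)))
      - 21 * (2 * a - 3) * ((4 * - a - 6) * tau
        - (18 * (- a - 1) + (4 * - a - 6) * (4 * (- a - 1) - 6 * - virz V)))).
    ring.
  by rewrite E1 [X in _ - _ * X]E1' !mulr0 subrr.
rewrite aE tauE => /eqP; rewrite (_ : _ - _ = - 280); last by ring.
by rewrite oppr_eq0 pnatr_eq0.
Qed.

(** * Laurent polynomials modulo constants *)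

Section HalfFunctions.
Variables (V : virOp M) (v w : M).
Hypotheses (noLW : no_hw (vir_mirror V)) (z0 : virz V = 0).
Hypotheses (w1 : V 0 w = w) (vw : V 2 v = w) (wv : V (-2) w = - v).
Hypotheses (Lm1w : V (-1) w = 0) (Lm2L1w : V (-2) (V 1 w) = 0).

(** With w = - t and L_n = t^(n+1) d/dt this is - k! t^(k+1), which explains the
    coefficients below. *)
Definition fpow k := iter k (V 1) w.

Lemma fpow_weight k : V 0 (fpow k) = k.+1%:R *: fpow k.
Proof.
elim: k => [|k IH]; first by rewrite scale1r.
by rewrite (virL0_weight 1 IH) !mulrSr; vring.
Qed.

Lemma fpowS k : fpow k.+1 = V 1 (fpow k). Proof. by []. Qed.

Arguments fpow : simpl never.

Lemma fpowLm1 k : V (-1) (fpow k.+1) = ((k%:R + 1) * (k%:R + 2)) *: fpow k.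
Proof.
have Lm1S u : V (-1) (V 1 u) = V 1 (V (-1) u) + 2 *: V 0 u.
  by rewrite virC1 subrK.
elim: k => [|k IH]; rewrite fpowS Lm1S fpow_weight.
  by rewrite Lm1w linear0; vring.
rewrite IH linearZ /= -fpowS !mulrSr; vring.
Qed.

Lemma fpowLm2 k :
  V (-2) (fpow k.+2) = ((k%:R + 1) * (k%:R + 2) * (k%:R + 3)) *: fpow k.
Proof.
have Lm2S u : V (-2) (V 1 u) = V 1 (V (-2) u) + 3 *: V (-1) u.
  exact: (@virC _ _ V (-2) 1 (-1) 3).
elim: k => [|k IH]; rewrite fpowS Lm2S fpowLm1.
  rewrite Lm2L1w linear0; vring.
rewrite IH linearZ /= -fpowS !mulrSr; vring.
Qed.

(** The difference of the two sides is killed by L_(-1) and L_(-2), by the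
    formulas for smaller k, so it would be a lowest weight vector. *)
Lemma fpowL2 k : (k%:R + 2) *: V 2 (fpow k) = fpow k.+2.
Proof.
suff Q n : (forall m, (m < n)%N -> (m%:R + 2) *: V 2 (fpow m) = fpow m.+2).
  exact: (Q k.+1).
elim: n => // n IH m; rewrite ltnS leq_eqVlt => /predU1P[-> {m}|]; last exact: IH.
apply/eqP; rewrite -subr_eq0; apply/eqP.
set q := _ - _.
have L2m u : V (-1) (V 2 u) = V 2 (V (-1) u) + 3 *: V 1 u by exact: (@virC _ _ V (-1) 2 1 3).
have L22 u : V (-2) (V 2 u) = V 2 (V (-2) u) + 4 *: V 0 u.
  by rewrite virC2 z0 mulr0 scale0r addr0 subrK.
have qn : V 0 q = (n%:R + 3) *: q.
  rewrite linearB linearZ /= (virL0_weight 2 (fpow_weight n)).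
  rewrite (fpow_weight n.+2) !mulrSr; vring.
apply: (noLW (mirror_weight qn)); rewrite vir_mirrorE linearB linearZ /=.
  rewrite L2m fpowLm1 -fpowS.
  case: n IH {q qn} => [|n] IH.
    rewrite Lm1w linear0 !mulrSr; vring.
  rewrite fpowLm1 linearZ /= -(IH n) // !mulrSr; vring.
rewrite L22 fpow_weight fpowLm2.
case: n IH {q qn} => [|[|n]] IH.
- rewrite wv linearN /= vw; vring.
- rewrite Lm2L1w linear0; vring.
rewrite fpowLm2 linearZ /= -(IH n) // !mulrSr; vring.
Qed.

Lemma fpow_closed (Q : M -> Prop) :
  (forall a k, Q (a *: fpow k)) -> Q 0 -> Q (- v) ->
  forall k, [/\ Q (V 1 (fpow k)), Q (V 2 (fpow k)),
    Q (V (-1) (fpow k)) & Q (V (-2) (fpow k))].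
Proof.
move=> Qf Q0 Qv k; split.
- by rewrite -fpowS -[fpow _]scale1r.
- have k2 : k%:R + 2 != 0 :> F by rewrite -natrD pnatr_eq0 addn2.
  by rewrite -[V 2 _](scalerK k2) fpowL2.
- by case: k => [|k]; rewrite ?Lm1w ?fpowLm1.
- by case: k => [|[|k]]; rewrite ?wv ?Lm2L1w ?fpowLm2.
Qed.

End HalfFunctions.

(** The multiples of t^k; the constants, k = 0, are zero in the quotient. *)
Definition function_vector V v w (k : int) : M :=
  match k with
  | Posz 0 => 0
  | Posz k.+1 => fpow V w k
  | Negz k => fpow (vir_mirror V) v k
  end.

(** The part of negative degree is the part of positive degree for the mirrored
    operators, with the roles of v and L_2 v exchanged. *)
Lemma function_module V a v : no_hw V -> no_hw (vir_mirror V) -> v != 0 ->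
  V 0 v = (a - 1) *: v -> gap_vector V v ->
  exists e : int -> M, [/\ e (-1) = v, forall k, V 0 (e k) = k%:~R *: e k &
    forall k n, n \in [:: 1; 2; -1; -2] -> exists j, span [:: e j] (V n (e k))].
Proof.
move=> noHW noLW v0 va gapv.
have [_ a0 z0 Tv] := constants noHW noLW v0 va gapv.
have [[v1 v2 v3 _ _] _ _] := gapv.
pose w := V 2 v; pose V' := vir_mirror V.
have noHW' : no_hw (vir_mirror V').
  move=> z u; rewrite !vir_mirrorE !opprK; exact: noHW.
have vN : V 0 v = - v by rewrite va a0 sub0r scaleN1r.
have wP : V 0 w = w by rewrite (virL0_weight 2 va) a0; vring.
have wv : V (-2) w = - v by [].
have Lm1w : V (-1) w = 0 by exact: Lm1L2_eq0.
have Lm2L1w : V (-2) (V 1 w) = 0 by rewrite -vir3.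
have z0' : virz V' = 0 by rewrite /= z0 oppr0.
have v1' : V' 0 v = v by rewrite vir_mirrorE oppr0 vN opprK.
have wv' : V' 2 w = v by rewrite vir_mirrorE wv opprK.
have vw' : V' (-2) v = - w by rewrite vir_mirrorE opprK.
have Lm1v' : V' (-1) v = 0 by rewrite vir_mirrorE opprK v1 oppr0.
have Lm2L1v' : V' (-2) (V' 1 v) = 0.
  by rewrite !vir_mirrorE !opprK linearN /= opprK.
exists (function_vector V v w); split=> [//|[[|k]|k]|k n].
- by rewrite linear0 scaler0.
- exact: fpow_weight.
- have := fpow_weight v1' k; rewrite vir_mirrorE oppr0 => /eqP.
  by rewrite eqr_oppLR -scaleNr => /eqP; rewrite NegzE mulrNz.
pose Q u := exists j, span [:: function_vector V v w j] u.
have QN u : Q (- u) -> Q u.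
  by case=> j /(spanZ (-1)); rewrite scaleN1r opprK; exists j.
have Qe j a' : Q (a' *: function_vector V v w j).
  by exists j; apply/spanZ/mem_span; rewrite inE.
have Q0 : Q 0 by exists 0; exact: span0.
have Qv : Q (- v) by rewrite -scaleN1r; exact: (Qe (-1)).
have Qw : Q (- w) by rewrite -scaleN1r; exact: (Qe 1).
rewrite !inE; case: k => [[|k]|k].
- by rewrite linear0.
- have Qp a' k' : Q (a' *: fpow V w k') by exact: (Qe k'.+1).
  have := fpow_closed noLW z0 wP erefl wv Lm1w Lm2L1w Qp Q0 Qv k.
  by case=> Q1 Q2 Q3 Q4 /or4P[] /eqP ->.
- have Qn a' k' : Q (a' *: fpow V' v k') by exact: (Qe (Negz k')).
  have := fpow_closed noHW' z0' v1' wv' vw' Lm1v' Lm2L1v' Qn Q0 Qw k.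
  case=> Q1 Q2 Q3 Q4 /or4P[] /eqP ->.
  + exact: QN Q3.
  + exact: QN Q4.
  + exact: QN Q1.
  + exact: QN Q2.
Qed.

End Virasoro.

(** * The Heisenberg part acts by zero *)

Section Heisenberg.
Variables (F : numFieldType) (M : lmodType F).
Implicit Types (A : hvOp M) (u v w : M).

Lemma hvI_pos A u : A 1 u = 0 -> hvI A 1 u = 0 ->
  forall n : nat, hvI A n.+1 u = 0.
Proof.
move=> u1 uI; elim=> [//|n IH]; apply/eqP.
have := hvLI A 1 n.+1 u; rewrite IH u1 !linear0 add0r.
rewrite (_ : (1 == - _) = false) ?mul0r ?scale0r ?addr0; last by lia.
by move/esym/eqP; rewrite scaler_eq0 intr_eq0.
Qed.

(** All I_n, n <> 0, kill w = L_2 v: for n > 0 because they kill v, for n < 0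
    because I_(-1) and L_(-1) kill w.  The brackets [L_(-1), I_1] and
    [L_(-2), I_2] on w then yield p = 0 and I_0 = q, which is exactly what makes
    the common kernel of the I_n, n <> 0, stable under every L_m. *)
Lemma hvI_vanish A v : hv_irr A -> A 1 v = 0 -> hvI A 1 v = 0 ->
  A 2 v != 0 -> A (-1) (A 2 v) = 0 -> hvI A (-1) (A 2 v) = 0 ->
  A 1 (lower2raise2 A v) = 0 -> hvI A 1 (lower2raise2 A v) = 0 ->
  forall n u, n != 0 -> hvI A n u = 0.
Proof.
move=> irrA v1 vI w_neq0 w1 wI v'1 v'I.
set w := A 2 v in w_neq0 w1 wI *.
have Ipw (n : nat) : hvI A n.+1 w = 0.
  have := hvLI A 2 n.+1 v; rewrite (hvI_pos v1 vI) linear0.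
  rewrite (_ : (2 == - _) = false) ?mul0r ?scale0r ?addr0; last by lia.
  by rewrite (hvI_pos v1 vI n.+2) scaler0 addr0.
have Inw (n : nat) : hvI A (Negz n) w = 0.
  by apply: (@hvI_pos (hv_mirror A)) => //; rewrite /= /mirror_fun /= w1 oppr0.
have scal0 (b : F) : b *: w = 0 -> b = 0.
  by move/eqP; rewrite scaler_eq0 (negPf w_neq0) orbF => /eqP.
have e1 : hvh A + hvp A - hvq A = 0.
  have := hvLI A (-1) 1 w; rewrite (Ipw 0%N) w1 !linear0 hvI0 => E.
  apply: scal0; rewrite [RHS]E /=; vring.
have e2 : 2 * hvh A + 4 * hvp A - 2 * hvq A = 0.
  have := hvLI A (-2) 2 w.
  rewrite (Ipw 1%N) -/(lower2raise2 A v) (hvI_pos v'1 v'I 1) !linear0 hvI0 => E.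
  apply: scal0; rewrite [RHS]E /=; vring.
have p0 : hvp A = 0.
  apply: (mulfI (_ : 2 != 0)); first by rewrite pnatr_eq0.
  transitivity ((2 * hvh A + 4 * hvp A - 2 * hvq A)
    - 2 * (hvh A + hvp A - hvq A)); first ring.
  by rewrite e1 e2 mulr0 subrr.
have hE : hvh A = hvq A.
  by apply/eqP; rewrite -subr_eq0; move: e1; rewrite p0 addr0 => ->.
pose W : set M := [set u | forall n, n != 0 -> hvI A n u = 0].
suff WT u : W u by move=> n u; exact: WT.
apply: irrA => [|m x xW n n0|m x xW n n0|].
- split=> [n _|x y xW yW n n0|b x xW n n0]; rewrite ?linear0 //.
  + by rewrite linearD xW ?yW ?addr0.
  + by rewrite linearZ /= xW ?scaler0.
- have /esym/eqP := hvLI A m n x; rewrite (xW n) // linear0 p0 mulr0 add0r.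
  have [mn|mn] := eqVneq m (- n).
    rewrite mn addNr hvI0 hE mul1r rmorphN mulNr scaleNr scalerA addrK.
    by move/eqP.
  by rewrite mul0r scale0r addr0 xW ?scaler0 ?addr0 ?addr_eq0 // => /eqP.
- by have [->|m0] := eqVneq m 0; rewrite ?hvI0 ?linearZ /= xW ?scaler0 ?linear0.
- exists w => // -[[|n]|n] //.
Qed.

Definition degree1_operators A : seq {linear M -> M} :=
  let c (f g : {linear M -> M}) : {linear M -> M} := f \o g in
  let T := c (A (-2)) (A 2) in
  [:: A 1; c (A 2) (A (-1)); c (A (-2)) (A 3);
      c (A 1) T; c (A 2) (c (A (-1)) T);
      c (A 2) (c (A (-3)) (A 2)); c (A (-2)) (c (A 3) T);
      hvI A 1; c (hvI A (-1)) (A 2); c (hvI A 1) T].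

Lemma degree1_conditions A z :
  infinite_dim (weight_sp A z) -> fin_dim (weight_sp A (z + 1)) ->
  exists v, [/\ v != 0, weight_sp A z v, gap_vector A v &
    [/\ hvI A 1 v = 0, hvI A (-1) (A 2 v) = 0 & hvI A 1 (lower2raise2 A v) = 0]].
Proof.
move=> infz finz.
have [|v [vz v0] v_neq0] := infinite_dim_neq0
  (infinite_dim_kernel (weight_sp_subspace A z) (phis := degree1_operators A) infz finz _).
  move=> phi phisP u uz.
  pose shift (d : int) (f : {linear M -> M}) :=
    forall y t, A 0 t = y *: t -> A 0 (f t) = (y + d%:~R) *: f t.
  have sL n : shift n (A n) by move=> y t; exact: virL0_weight.
  have sI n : shift n (hvI A n) by move=> y t; exact: hvI_weight.
  have sC d d' (f g : {linear M -> M}) :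
      shift d f -> shift d' g -> shift (d' + d) (f \o g).
    by move=> sf sg y t /sg /sf ->; rewrite rmorphD addrA.
  suff s1 : shift 1 phi by exact: s1.
  have sT := sC _ _ _ _ (sL (-2)) (sL 2).
  case: phisP => [<-|]; first exact: (sL 1).
  case=> [<-|]; first exact: (sC _ _ _ _ (sL 2) (sL (-1))).
  case=> [<-|]; first exact: (sC _ _ _ _ (sL (-2)) (sL 3)).
  case=> [<-|]; first exact: (sC _ _ _ _ (sL 1) sT).
  case=> [<-|]; first exact: (sC _ _ _ _ (sL 2) (sC _ _ _ _ (sL (-1)) sT)).
  case=> [<-|]; first exact: (sC _ _ _ _ (sL 2) (sC _ _ _ _ (sL (-3)) (sL 2))).
  case=> [<-|]; first exact: (sC _ _ _ _ (sL (-2)) (sC _ _ _ _ (sL 3) sT)).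
  case=> [<-|]; first exact: (sI 1).
  case=> [<-|]; first exact: (sC _ _ _ _ (sI (-1)) (sL 2)).
  case=> [<-|//]; exact: (sC _ _ _ _ (sI 1) sT).
have cons (phi : {linear M -> M}) phis :
    (forall psi : {linear M -> M}, List.In psi (phi :: phis) -> psi v = 0) ->
    phi v = 0 /\ forall psi : {linear M -> M}, List.In psi phis -> psi v = 0.
  by move=> H; split=> [|psi ?]; apply: H; [left | right].
move: v0 => /cons[c1] /cons[c2] /cons[c3] /cons[c4] /cons[c5] /cons[c6].
move=> /cons[c7] /cons[c8] /cons[c9] /cons[c10] _.
by exists v; split.
Qed.

End Heisenberg.

(** * Infinite-dimensional weight spaces propagate *)

Section Support.
Variables (F : numFieldType) (M : lmodType F).
Implicit Types (A : hvOp M).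

Lemma hv_mirror_irr A : hv_irr A -> hv_irr (hv_mirror A).
Proof.
move=> irrA W subW WL WI; apply: irrA => // n u Wu.
  have := WL (- n) u Wu; rewrite /= /mirror_fun /= opprK => nu.
  by rewrite -[A n u]opprK -scaleN1r; case: subW => _ _; apply.
by have := WI (- n) u Wu; rewrite /= opprK.
Qed.

Lemma mirror_weight_sp A z : weight_sp (hv_mirror A) (- z) = weight_sp A z.
Proof.
apply/seteqP; split=> u; rewrite /weight_sp /= /mirror_fun /= oppr0 scaleNr.
  exact: oppr_inj.
by move=> ->.
Qed.

Lemma infinite_weight_no_hw A z : hv_irr A -> infinite_dim (weight_sp A z) ->
  (forall u, hvI A 1 u = 0) -> no_hw A.
Proof.
move=> irrA infz I1 y u uy u1 u2; apply: contrapT => /eqP u0; apply: infz.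
exact: (hw_fin_dim irrA u0 uy u1 u2 (I1 u)).
Qed.

(** Otherwise the vectors of [function_module] would span a submodule with
    weight spaces of dimension at most one. *)
Lemma infinite_weight_succ A z : hv_irr A ->
  infinite_dim (weight_sp A z) -> infinite_dim (weight_sp A (z + 1)).
Proof.
move=> irrA infz finz1.
have [v [v0 vz gapv [vI wI v'I]]] := degree1_conditions infz finz1.
have [hgapv _ _] := gapv; have [v1 v2 _ v'1 _] := hgapv.
have w0 : A 2 v != 0.
  apply/eqP => w0; apply: infz.
  exact: (hw_fin_dim irrA v0 vz v1 w0 vI).
have I0 := hvI_vanish irrA v1 vI w0 (Lm1L2_eq0 v1 v2) wI v'1 v'I.
have noHW : no_hw A by apply: infinite_weight_no_hw infz _ => // u; exact: I0.
have noLW : no_hw (vir_mirror A).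
  apply: (@infinite_weight_no_hw (hv_mirror A) (- z)).
  - exact: hv_mirror_irr.
  - by rewrite mirror_weight_sp.
  - by move=> u; exact: I0.
have va : A 0 v = (z + 1 - 1) *: v by rewrite addrK.
have [e [e1 e_wt e_st]] := function_module noHW noLW v0 va gapv.
apply: infz; apply: (@graded_fin_dim _ _ A irrA int (fun j => [:: e j]) (fun j => j%:~R)).
- exact: intr_inj.
- by move=> j b; rewrite inE => /eqP->.
- split=> j b; rewrite inE => /eqP->; [exact: e_st | exact: e_st |].
  by exists j; rewrite I0 //; exact: span0.
- split=> j b; rewrite inE => /eqP->.
  + have [k jk] := e_st j (-1) isT; exists k.
    by rewrite /= /mirror_fun /= -scaleN1r; exact: spanZ.
  + have [k jk] := e_st j (-2) isT; exists k.
    by rewrite /= /mirror_fun /= -scaleN1r; exact: spanZ.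
  + by exists j; rewrite /= I0 //; exact: span0.
- by exists (-1), v; rewrite // e1 inE.
Qed.

Lemma infinite_weight_coset A z (k : int) : hv_irr A ->
  infinite_dim (weight_sp A z) -> infinite_dim (weight_sp A (z + k%:~R)).
Proof.
move=> irrA infz; have up (n : nat) (A' : hvOp M) y : hv_irr A' ->
    infinite_dim (weight_sp A' y) -> infinite_dim (weight_sp A' (y + n%:R)).
  move=> irrA' infy; elim: n => [|n IH]; first by rewrite addr0.
  by rewrite mulrSr addrA; exact: infinite_weight_succ.
case: k => n; first exact: up.
rewrite -mirror_weight_sp NegzE mulrNz opprD opprK.
by apply: up; [exact: hv_mirror_irr | rewrite mirror_weight_sp].
Qed.

(** The vectors killed by some product of factors L_0 - (z + k) form a
    submodule: an operator of degree m turns the factor for k into the one for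
    k + m. *)
Lemma weight_coset A z y v u : hv_irr A -> v != 0 -> weight_sp A z v ->
  u != 0 -> weight_sp A y u -> exists k : int, y = z + k%:~R.
Proof.
move=> irrA v0 vz u0 uy.
pose coset (t : seq F) := forall x, x \in t -> exists k : int, x = z + k%:~R.
pose W : set M := [set u | exists2 t, coset t & kill A t u = 0].
have shiftW (m : int) (f : {linear M -> M}) :
    (forall x, A 0 (f x) = f (A 0 x) + m%:~R *: f x) -> stable_under W f.
  move=> fm x [t tz tx]; exists [seq y + m%:~R | y <- t].
    move=> _ /mapP[x' /tz[k ->] ->]; exists (k + m).
    by rewrite rmorphD addrA.
  suff -> : kill A [seq y + m%:~R | y <- t] (f x) = f (kill A t x).
    by rewrite tx linear0.
  elim: t {tz tx} => //= x' t ->; rewrite fm [f (_ - _)]linearB [f (_ *: _)]linearZ /=; vring.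
have [t tz tu] : W u.
  apply: irrA => [|n|n|].
  - split=> [|x y' [s sz sx] [t tz ty]|a x [t tz tx]].
    + by exists [::].
    + exists (s ++ t) => [x'|]; first by rewrite mem_cat => /orP[/sz|/tz].
      by rewrite killD kill_cat killC sx kill0 add0r kill_cat ty kill0.
    + by exists t; rewrite // killZ tx scaler0.
  - apply: (shiftW n) => x; rewrite virLL /= subr0 add0r.
    by rewrite (_ : 0 ^+ 3 - 0 = 0) // mulr0 mul0r scale0r addr0.
  - by apply: (shiftW n) => x; rewrite hvLI add0r; vring.
  exists v => //; exists [:: z]; last by rewrite /= vz subrr.
  by move=> x; rewrite inE => /eqP->; exists 0; rewrite addr0.
exact/tz/(kill_weight_eq0 uy tu u0).
Qed.

End Support.

(** * From modules to operators *)

Section HVModule.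
Variables (F : numFieldType) (M : lieModType (HV F)).
Hypotheses (M_irr : irreducible_module M) (M_weight : weight_module M).

Definition act (x : HV F) (u : M) : M := lact x u.

HB.instance Definition _ x :=
  GRing.isLinear.Build F M M *:%R (act x) (lact_linearr x).

Lemma actD x y u : act (x + y) u = act x u + act y u.
Proof. by have := lact_linearl u 1 x y; rewrite !scale1r. Qed.

Lemma act0 u : act 0 u = 0.
Proof. by apply: (@addrI _ (act 0 u)); rewrite -actD !addr0. Qed.

Lemma actZ a x u : act (a *: x) u = a *: act x u.
Proof. by have := lact_linearl u a x 0; rewrite -!/(act _ _) !addr0 act0 addr0. Qed.

Lemma act_comm x y u : act x (act y u) = act y (act x u) + act (lieb x y) u.
Proof. by rewrite /act lact_lieb addrC subrK. Qed.

Lemma irr_subspace (W : set M) : subspace W ->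
  (forall g, stable_under W (act (HV_gen F g))) ->
  (exists2 u, W u & u != 0) -> forall u, W u.
Proof.
move=> [W0 WD WZ] Wg [u Wu u0]; have [_ irr] := M_irr.
have [|W_0|-> //] := irr W; last by move: Wu u0; rewrite W_0 => -> /eqP.
split=> // x v Wv; elim/HV_lin_ind: x => [|a g x IH]; first by rewrite -/(act _ _) act0.
by rewrite -/(act _ _) actD actZ; apply: WD => //; apply/WZ/Wg.
Qed.

(** Diagonalizability provides an eigenvector of the central element z, and the
    eigenspace is a submodule. *)
Lemma central_scalar z : HV_cartan z -> (forall x, lieb x z = 0) ->
  exists c : F, forall u, act z u = c *: u.
Proof.
move=> Hz zc; have [[v v0] _] := M_irr; have [s [sw vE]] := M_weight v.
have [w [ws w0]] : exists w, w \in s /\ w != 0.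
  apply: contrapT => s0; move/eqP: v0; apply; rewrite vE big1_seq // => w /= ws.
  by apply: contrapT => /eqP w0; apply: s0; exists w.
have [mu muw] := sw w ws; exists (mu z).
pose W : set M := [set u | act z u = mu z *: u].
suff : forall u, W u by [].
apply: irr_subspace => [|g u Wu|].
- split=> [|u1 u2 W1 W2|a u Wu]; rewrite /W /=.
  + by rewrite [act z _]linear0 scaler0.
  + by rewrite [act z _]linearD /= W1 W2 scalerDr.
  + by rewrite [act z _]linearZ /= Wu !scalerA mulrC.
- have := act_comm (HV_gen F g) z u; rewrite zc act0 addr0 Wu linearZ /=.
  exact: esym.
- by exists w => //; apply: muw.
Qed.

Lemma cartan_I0 : HV_cartan (HV_I F 0).
Proof. by exists 0, 1, 0, 0, 0; rewrite !scale0r scale1r add0r !addr0. Qed.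

Lemma cartan_C : HV_cartan (HV_C F).
Proof. by exists 0, 0, 1, 0, 0; rewrite !scale0r scale1r !add0r !addr0. Qed.

Lemma cartan_CLI : HV_cartan (HV_CLI F).
Proof. by exists 0, 0, 0, 1, 0; rewrite !scale0r scale1r !add0r !addr0. Qed.

Lemma cartan_CI : HV_cartan (HV_CI F).
Proof. by exists 0, 0, 0, 0, 1; rewrite !scale0r scale1r !add0r. Qed.

Lemma I0_central x : lieb x (HV_I F 0) = 0.
Proof.
elim/HV_lin_ind: x => [|a g x IH]; rewrite /lieb /= ?HV_lieb0l // HV_lieb_linearl.
rewrite -/(lieb _ _) [X in _ + X]IH addr0 /lieb /= HV_liebU.
case: g => [n|n|||] /=; rewrite ?scaler0 // ?/HV_gen_LI ?/HV_gen_II oppr0.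
  case: eqP => [->|_]; last by rewrite mul0r !scale0r addr0 scaler0.
  by rewrite expr0n /= mulr0 !scale0r addr0 scaler0.
by case: eqP => [->|_]; rewrite ?mul0r ?mulr0 scale0r scaler0.
Qed.

(** The central elements C, C_I, C_LI and I_0 act by scalars, so the L_n and I_n
    satisfy the relations of [hvOp]. *)
Lemma HV_operators : exists A : hvOp M, hv_irr A /\
  forall n u, A n u = lact (HV_L F n) u.
Proof.
have [c cE] : exists c : F, forall u, act (HV_C F) u = c *: u.
  by apply: central_scalar cartan_C _ => x; case: (HV_lieb_central x).
have [p pE] : exists c : F, forall u, act (HV_CLI F) u = c *: u.
  by apply: central_scalar cartan_CLI _ => x; case: (HV_lieb_central x).
have [e eE] : exists c : F, forall u, act (HV_CI F) u = c *: u.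
  by apply: central_scalar cartan_CI _ => x; case: (HV_lieb_central x).
have [h hE] := central_scalar cartan_I0 I0_central.
pose L n : {linear M -> M} := act (HV_L F n).
pose I n : {linear M -> M} := act (HV_I F n).
have LL n m u : L n (L m u) = L m (L n u) + (m - n)%:~R *: L (n + m) u
    + ((n == - m)%:R * (n ^+ 3 - n)%:~R * (c / 12)) *: u.
  rewrite /L /= act_comm HV_lieb_LL actD !actZ cE addrA scalerA.
  by congr (_ + _ *: _); rewrite -!mulrA (mulrC c).
have LI n m u : L n (I m u) = I m (L n u) + m%:~R *: I (n + m) u
    + ((n == - m)%:R * ((n ^+ 2)%:~R * p + n%:~R * p)) *: u.
  rewrite /L /I /= act_comm HV_lieb_LI actD !actZ pE addrA scalerA.
  by congr (_ + _ *: _); rewrite -mulrDl -rmorphD mulrA.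
have II n m u : I n (I m u) = I m (I n u) + (n%:~R * (n == - m)%:R * e) *: u.
  by rewrite /I /= act_comm HV_lieb_II actZ eE scalerA.
pose V := VirOp LL.
pose A : hvOp M := @HVOp _ _ V I p p e h LI II hE.
exists A; split=> // W subW WL WI; apply: irr_subspace => // -[n|n|||].
- exact: WL.
- exact: WI.
- by move=> u Wu; rewrite [act _ u]cE; case: subW => _ _; apply.
- by move=> u Wu; rewrite [act _ u]eE; case: subW => _ _; apply.
- by move=> u Wu; rewrite [act _ u]pE; case: subW => _ _; apply.
Qed.

End HVModule.

Theorem theorem1p3 (R : realType) (M : lieModType (HV R[i])) (lambda : R[i])
    (M_irr : irreducible_module M) (M_weight : weight_module M)
    (dim_lambda : infinite_dim (weight_space M lambda)) :
  Supp M = [set lambda + k%:~R | k in [set: int]] /\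
  forall k : int, infinite_dim (weight_space M (lambda + k%:~R)).
Proof.
have [A [irrA AE]] := HV_operators M_irr M_weight.
have wsE z : weight_space M z = weight_sp A z.
  by apply/seteqP; split=> u; rewrite /weight_space /weight_sp /= AE.
have inf k : infinite_dim (weight_space M (lambda + k%:~R)).
  by rewrite wsE; apply: infinite_weight_coset => //; rewrite -wsE.
split=> //; apply/seteqP; split=> [mu [u u_mu u0]|_ [k _ <-]]; last first.
  by have [v vk v0] := infinite_dim_neq0 (inf k); exists v.
have [v v_la v0] := infinite_dim_neq0 dim_lambda.
rewrite wsE in u_mu; rewrite wsE in v_la.
by have [k ->] := weight_coset irrA v0 v_la u0 u_mu; exists k.
Qed.
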